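(* For every $n \geq 5$ and every collection of non-trivial groups $\mathcal{G}=\{G_i \mid i\in\mathbb{Z}/n\mathbb{Z}\}$, $$\mathrm{Aut}(C_n\mathcal{G})= \mathrm{Inn} \cdot \mathrm{Loc} \simeq C_n\mathcal{G} \rtimes \left( \left( \prod_{i\in\mathbb{Z}/n\mathbb{Z}} \mathrm{Aut}(G_i) \right) \rtimes \mathrm{Sym} \right).$$
   Context: The cyclic product $C_n\mathcal{G}$ is the quotient of the free product $\ast_{i} G_i$ by the relations $gh=hg$ for all $g\in G_i$, $h\in G_{i+1}$, $i \in \mathbb{Z}/n\mathbb{Z}$ (indices modulo $n$). It is the graph product of the $G_i$ over the cycle $C_n$ with vertex set $\mathbb{Z}/n\mathbb{Z}$. $\mathrm{Inn}$ is the group of inner automorphisms of $C_n\mathcal{G}$. A local automorphism of $C_n\mathcal{G}$ is an automorphism determined by a pair $(\sigma,\Phi)$, where $\sigma$ is a symmetry (graph automorphism) of $C_n$ and $\Phi=\{\varphi_i: G_i\to G_{\sigma(i)} \mid i\in\mathbb{Z}/n\mathbb{Z}\}$ is a collection of isomorphisms, via $g\mapsto\varphi_i(g)$ for every $i$ and every $g\in G_i$. $\mathrm{Loc}$ is the subgroup of $\mathrm{Aut}(C_n\mathcal{G})$ consisting of the local automorphisms. $\mathrm{Sym}$ is the group of symmetries $\sigma$ of $C_n$ preserving the isomorphism classes of the vertex-groups, i.e. $G_{\sigma(i)} \cong G_i$ for all $i$. The semi-direct products are the natural ones: fix isomorphisms $\theta_{i,j}: G_i \to G_j$ for all $i,j$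 with $G_i\cong G_j$, such that $\theta_{i,i}=\mathrm{id}$ and $\theta_{j,k}\circ\theta_{i,j}=\theta_{i,k}$. An element $\sigma\in\mathrm{Sym}$ acts on $\prod_i \mathrm{Aut}(G_i)$ by $(\sigma\cdot\alpha)_{\sigma(i)} = \theta_{i,\sigma(i)}\circ\alpha_i\circ\theta_{i,\sigma(i)}^{-1}$, and a pair $(\alpha,\sigma)\in (\prod_i \mathrm{Aut}(G_i))\rtimes\mathrm{Sym}$ acts on $C_n\mathcal{G}$ as the local automorphism sending $g\in G_i$ to $\alpha_{\sigma(i)}(\theta_{i,\sigma(i)}(g))\in G_{\sigma(i)}$. *)

(* Defs.v *)
From HB Require Import structures.
From mathcomp Require Import all_boot perm ssralg zmodp.
From mathcomp Require Import boolp classical_sets.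

Set Implicit Arguments.
Unset Strict Implicit.
Unset Printing Implicit Defensive.

Local Open Scope quotient_scope.
Local Open Scope group_scope.

Record giso (G H : groupType) := GIso {
  giso_fun :> G -> H;
  giso_inv : H -> G;
  gisoM : {morph giso_fun : x y / x * y};
  gisoK : cancel giso_fun giso_inv;
  gisoKV : cancel giso_inv giso_fun
}.

Definition isomorphic (G H : groupType) : Prop := inhabited (giso G H).

Lemma giso_ext (G H : groupType) (f g : giso G H) : f =1 g -> f = g.
Proof.
move=> fg; case: f g fg => f f' fM fK f'K [g g' gM gK g'K] /= /funext fg.
subst g; have /funext e : f' =1 g' by move=> x; rewrite -{1}(g'K x) fK.
by subst g'; congr GIso; apply: Prop_irrelevance.
Qed.

Lemma morph_one (G H : groupType) (f : G -> H) :
  {morph f : x y / x * y} -> f 1 = 1.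
Proof. by move=> fM; apply: (mulgI (f 1)); rewrite -fM !mulg1. Qed.

Lemma morph_inv (G H : groupType) (f : G -> H) :
  {morph f : x y / x * y} -> {morph f : x / x^-1}.
Proof.
by move=> fM x; apply: (mulgI (f x)); rewrite -fM !mulgV morph_one.
Qed.

Lemma gisoVM (G H : groupType) (f : giso G H) :
  {morph giso_inv f : x y / x * y}.
Proof.
by move=> x y; rewrite -{1}(gisoKV f x) -{1}(gisoKV f y) -gisoM gisoK.
Qed.

Definition giso_id (G : groupType) : giso G G :=
  @GIso G G id id (fun _ _ => erefl) (fun _ => erefl) (fun _ => erefl).

Definition giso_sym (G H : groupType) (f : giso G H) : giso H G :=
  GIso (gisoVM f) (gisoKV f) (gisoK f).

Lemma giso_compM (G H K : groupType) (g : giso H K) (f : giso G H) :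
  {morph (g \o f) : x y / x * y}.
Proof. by move=> x y /=; rewrite !gisoM. Qed.

Definition giso_comp (G H K : groupType) (g : giso H K) (f : giso G H) :
    giso G K :=
  GIso (giso_compM g f) (can_comp (gisoK g) (gisoK f))
    (can_comp (gisoKV f) (gisoKV g)).

Definition gaut (G : groupType) := giso G G.

(* The product a * b of automorphisms is the composite a \o b. *)
Section AutomorphismGroup.
Variable G : groupType.

HB.instance Definition _ := gen_eqMixin (gaut G).
HB.instance Definition _ := gen_choiceMixin (gaut G).

Definition gaut_mul (a b : gaut G) : gaut G := giso_comp a b.
Definition gaut_one : gaut G := giso_id G.
Definition gaut_inv (a : gaut G) : gaut G := giso_sym a.

Lemma gaut_mulA : associative gaut_mul.
Proof. by move=> a b c; apply: giso_ext. Qed.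
Lemma gaut_mul1 : left_id gaut_one gaut_mul.
Proof. by move=> a; apply: giso_ext. Qed.
Lemma gaut_1mul : right_id gaut_one gaut_mul.
Proof. by move=> a; apply: giso_ext. Qed.
Lemma gaut_mulV : left_inverse gaut_one gaut_inv gaut_mul.
Proof. by move=> a; apply: giso_ext => x /=; rewrite gisoK. Qed.
Lemma gaut_Vmul : right_inverse gaut_one gaut_inv gaut_mul.
Proof. by move=> a; apply: giso_ext => x /=; rewrite gisoKV. Qed.

HB.instance Definition _ := isGroup.Build (gaut G)
  gaut_mulA gaut_mul1 gaut_1mul gaut_mulV gaut_Vmul.

End AutomorphismGroup.

Lemma gautM (G : groupType) (a b : gaut G) x : (a * b) x = a (b x).
Proof. by []. Qed.

Lemma gaut1 (G : groupType) (x : G) : (1 : gaut G) x = x.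
Proof. by []. Qed.

Definition Inn (G : groupType) : set (gaut G) :=
  [set a | exists x : G, forall y, a y = x * y * x^-1]%classic.
Arguments Inn : clear implicits.

Definition gprod (I : Type) (K : I -> groupType) : Type := forall i, K i.

Section DirectProduct.
Variables (I : Type) (K : I -> groupType).

HB.instance Definition _ := gen_eqMixin (gprod K).
HB.instance Definition _ := gen_choiceMixin (gprod K).

Definition gprod_mul (u v : gprod K) : gprod K := fun i => u i * v i.
Definition gprod_one : gprod K := fun i => 1.
Definition gprod_inv (u : gprod K) : gprod K := fun i => (u i)^-1.

Lemma gprod_mulA : associative gprod_mul.
Proof.
by move=> u v w; apply: functional_extensionality_dep => i; exact: mulgA.
Qed.
Lemma gprod_mul1 : left_id gprod_one gprod_mul.
Proof.
by move=> u; apply: functional_extensionality_dep => i; exact: mul1g.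
Qed.
Lemma gprod_1mul : right_id gprod_one gprod_mul.
Proof.
by move=> u; apply: functional_extensionality_dep => i; exact: mulg1.
Qed.
Lemma gprod_mulV : left_inverse gprod_one gprod_inv gprod_mul.
Proof.
by move=> u; apply: functional_extensionality_dep => i; exact: mulVg.
Qed.
Lemma gprod_Vmul : right_inverse gprod_one gprod_inv gprod_mul.
Proof.
by move=> u; apply: functional_extensionality_dep => i; exact: mulgV.
Qed.

HB.instance Definition _ := isGroup.Build (gprod K)
  gprod_mulA gprod_mul1 gprod_1mul gprod_mulV gprod_Vmul.

End DirectProduct.

(* sdprod phi is the semi-direct product of N and H, with H acting on N by
   phi, on the set of pairs (n, h). *)
Definition sdprod (N H : groupType) (phi : {multiplicative H -> gaut N}) :
  Type := (N * H)%type.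

Section SemidirectProduct.
Variables (N H : groupType) (phi : {multiplicative H -> gaut N}).

HB.instance Definition _ := Choice.on (sdprod phi).

Definition sdprod_mul (u v : sdprod phi) : sdprod phi :=
  (u.1 * phi u.2 v.1, u.2 * v.2).
Definition sdprod_one : sdprod phi := (1, 1).
Definition sdprod_inv (u : sdprod phi) : sdprod phi :=
  (phi u.2^-1 u.1^-1, u.2^-1).

Let phi1 x : phi 1 x = x.
Proof. by rewrite (morph_one (@gmulfM _ _ phi)). Qed.

Lemma sdprod_mulA : associative sdprod_mul.
Proof.
move=> u v w; congr pair; last exact: mulgA.
by rewrite /= gmulfM gisoM mulgA.
Qed.
Lemma sdprod_mul1 : left_id sdprod_one sdprod_mul.
Proof. by case=> n h; rewrite /sdprod_mul /= phi1 !mul1g. Qed.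
Lemma sdprod_1mul : right_id sdprod_one sdprod_mul.
Proof.
by case=> n h; rewrite /sdprod_mul /= (morph_one (gisoM (phi h))) !mulg1.
Qed.
Lemma sdprod_mulV : left_inverse sdprod_one sdprod_inv sdprod_mul.
Proof.
case=> n h; rewrite /sdprod_mul /sdprod_inv /= mulVg -gisoM mulVg.
by rewrite (morph_one (gisoM _)).
Qed.
Lemma sdprod_Vmul : right_inverse sdprod_one sdprod_inv sdprod_mul.
Proof.
case=> n h; rewrite /sdprod_mul /sdprod_inv /= mulgV -gautM -gmulfM mulgV.
by rewrite phi1 mulgV.
Qed.

HB.instance Definition _ := isGroup.Build (sdprod phi)
  sdprod_mulA sdprod_mul1 sdprod_1mul sdprod_mulV sdprod_Vmul.

End SemidirectProduct.

Section FreeProduct.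
Variables (I : choiceType) (G : I -> groupType).

Definition word : Type := seq {i & G i}.

HB.instance Definition _ := Choice.on word.

Definition letter i (g : G i) : {i & G i} := Tagged G g.

(* The least congruence on words that identifies the one-letter word of a
   neutral element with the empty word, and a two-letter word in a single
   factor with its product. *)
Inductive free_eq : word -> word -> Prop :=
| FreeRefl w : free_eq w w
| FreeSym w1 w2 : free_eq w1 w2 -> free_eq w2 w1
| FreeTrans w1 w2 w3 : free_eq w1 w2 -> free_eq w2 w3 -> free_eq w1 w3
| FreeCat u1 u2 v1 v2 :
    free_eq u1 u2 -> free_eq v1 v2 -> free_eq (u1 ++ v1) (u2 ++ v2)
| FreeOne i : free_eq [:: letter (1 : G i)] [::]
| FreeMul i (g h : G i) :
    free_eq [:: letter g; letter h] [:: letter (g * h)].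

Definition free_eqb : rel word := fun u v => `[< free_eq u v >].

Lemma free_eqb_refl : reflexive free_eqb.
Proof. by move=> u; apply/asboolP/FreeRefl. Qed.
Lemma free_eqb_sym : symmetric free_eqb.
Proof. by move=> u v; apply/asboolP/asboolP; apply: FreeSym. Qed.
Lemma free_eqb_trans : transitive free_eqb.
Proof.
by move=> v u w /asboolP uv /asboolP vw; apply/asboolP/(FreeTrans uv vw).
Qed.

Canonical free_equiv := EquivRel free_eqb free_eqb_refl free_eqb_sym
  free_eqb_trans.

Definition free_prod_type := {eq_quot free_equiv}.
HB.instance Definition _ := Choice.on free_prod_type.
HB.instance Definition _ := Quotient.on free_prod_type.

Definition free_mk (w : word) : free_prod_type := \pi w.

Lemma free_mkP u v : free_mk u = free_mk v <-> free_eq u v.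
Proof.
split=> [e|uv]; first by apply/asboolP/(eqmodP free_equiv).
by apply/(eqmodP free_equiv)/asboolP.
Qed.

Lemma free_reprK x : free_mk (repr x) = x.
Proof. exact: reprK. Qed.

Lemma free_mk_repr u : free_eq (repr (free_mk u)) u.
Proof. by apply/free_mkP; rewrite free_reprK. Qed.

Definition word_inv (w : word) : word :=
  rev [seq letter (tagged l : G (tag l))^-1 | l <- w].

Definition free_mul (x y : free_prod_type) := free_mk (repr x ++ repr y).
Definition free_one := free_mk [::].
Definition free_inv (x : free_prod_type) := free_mk (word_inv (repr x)).

Lemma free_mkM u v : free_mul (free_mk u) (free_mk v) = free_mk (u ++ v).
Proof. by apply/free_mkP/FreeCat; apply: free_mk_repr. Qed.

Lemma word_mulV w : free_eq (word_inv w ++ w) [::].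
Proof.
elim: w => [|[i g] w IHw]; first exact: FreeRefl.
rewrite /word_inv /= rev_cons -cats1 -catA.
apply: FreeTrans IHw; apply: FreeCat; first exact: FreeRefl.
apply: (@FreeCat [:: letter g^-1; letter g] [::] w w); last exact: FreeRefl.
apply: FreeTrans (FreeOne i); rewrite -(mulVg g); exact: FreeMul.
Qed.

Lemma word_Vmul w : free_eq (w ++ word_inv w) [::].
Proof.
elim: w => [|[i g] w IHw]; first exact: FreeRefl.
rewrite /word_inv /= rev_cons -cats1 -/(word_inv w) catA.
apply: (@FreeTrans _ [:: letter g; letter g^-1]).
  apply: (@FreeCat [:: letter g] [:: letter g]); first exact: FreeRefl.
  apply: (@FreeCat _ [::] [:: letter g^-1]) => //; exact: FreeRefl.
apply: FreeTrans (FreeOne i); rewrite -(mulgV g); exact: FreeMul.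
Qed.

Lemma free_mulA : associative free_mul.
Proof.
move=> x y z; rewrite -(free_reprK x) -(free_reprK y) -(free_reprK z).
by rewrite !free_mkM catA.
Qed.
Lemma free_mul1 : left_id free_one free_mul.
Proof. by move=> x; rewrite -(free_reprK x) free_mkM. Qed.
Lemma free_1mul : right_id free_one free_mul.
Proof. by move=> x; rewrite -(free_reprK x) free_mkM cats0. Qed.
Lemma free_mulV : left_inverse free_one free_inv free_mul.
Proof.
by move=> x; rewrite -{2}(free_reprK x) free_mkM; apply/free_mkP/word_mulV.
Qed.
Lemma free_Vmul : right_inverse free_one free_inv free_mul.
Proof.
by move=> x; rewrite -{1}(free_reprK x) free_mkM; apply/free_mkP/word_Vmul.
Qed.

HB.instance Definition _ := isGroup.Build free_prod_type
  free_mulA free_mul1 free_1mul free_mulV free_Vmul.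

Definition free_prod : groupType := free_prod_type.

Definition free_in i (g : G i) : free_prod := free_mk [:: letter g].

Lemma free_inM i : {morph @free_in i : g h / g * h}.
Proof.
by move=> g h; rewrite [RHS]free_mkM; apply/free_mkP/FreeSym/FreeMul.
Qed.

Lemma free_ind (P : free_prod -> Prop) :
  P 1 -> (forall i (g : G i) x, P x -> P (free_in g * x)) -> forall x, P x.
Proof.
move=> P1 PM x; rewrite -(free_reprK x); elim: (repr x) => [|[i g] w IHw] //.
by have := PM _ g _ IHw; rewrite [_ * _]free_mkM.
Qed.

Section Lift.
Variables (H : groupType) (f : forall i, G i -> H).
Hypothesis fM : forall i, {morph @f i : g h / g * h}.

Definition word_lift (w : word) : H := \prod_(l <- w) f (tagged l).

Lemma word_lift_eq u v : free_eq u v -> word_lift u = word_lift v.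
Proof.
elim=> {u v} [//|//|w1 w2 w3 _ -> _ ->//|u1 u2 v1 v2 _ IHu _ IHv|i|i g h].
- by rewrite /word_lift !big_cat /= -/(word_lift u1) IHu -/(word_lift v1) IHv.
- by rewrite /word_lift big_seq1 big_nil /= (morph_one (@fM i)).
- by rewrite /word_lift big_cons !big_seq1 /= fM.
Qed.

Definition free_lift (x : free_prod) : H := word_lift (repr x).

Lemma free_lift_mk w : free_lift (free_mk w) = word_lift w.
Proof. by apply: word_lift_eq; apply: free_mk_repr. Qed.

Lemma free_liftM : {morph free_lift : x y / x * y}.
Proof.
move=> x y; rewrite -(free_reprK x) -(free_reprK y) [_ * _ in LHS]free_mkM.
by rewrite !free_lift_mk /word_lift big_cat.
Qed.

Lemma free_lift_in i (g : G i) : free_lift (free_in g) = f g.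
Proof. by rewrite free_lift_mk /word_lift big_seq1. Qed.

End Lift.

End FreeProduct.

(* The quotient of a group by a set R of relations x = y, that is, by the
   least congruence containing R. *)
Section GroupQuotient.
Variables (G : groupType) (R : G -> G -> Prop).

Inductive gcong : G -> G -> Prop :=
| GCongRel x y : R x y -> gcong x y
| GCongRefl x : gcong x x
| GCongSym x y : gcong x y -> gcong y x
| GCongTrans x y z : gcong x y -> gcong y z -> gcong x z
| GCongMul x1 x2 y1 y2 :
    gcong x1 x2 -> gcong y1 y2 -> gcong (x1 * y1) (x2 * y2).

Definition gcongb : rel G := fun u v => `[< gcong u v >].

Lemma gcongb_refl : reflexive gcongb.
Proof. by move=> u; apply/asboolP/GCongRefl. Qed.
Lemma gcongb_sym : symmetric gcongb.
Proof. by move=> u v; apply/asboolP/asboolP; apply: GCongSym. Qed.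
Lemma gcongb_trans : transitive gcongb.
Proof.
by move=> v u w /asboolP uv /asboolP vw; apply/asboolP/(GCongTrans uv vw).
Qed.

Canonical gcong_equiv := EquivRel gcongb gcongb_refl gcongb_sym gcongb_trans.

Definition gquot_type := {eq_quot gcong_equiv}.
HB.instance Definition _ := Choice.on gquot_type.
HB.instance Definition _ := Quotient.on gquot_type.

Definition gquot_mk (x : G) : gquot_type := \pi x.

Lemma gquot_mkP x y : gquot_mk x = gquot_mk y <-> gcong x y.
Proof.
split=> [e|uv]; first by apply/asboolP/(eqmodP gcong_equiv).
by apply/(eqmodP gcong_equiv)/asboolP.
Qed.

Lemma gquot_reprK x : gquot_mk (repr x) = x.
Proof. exact: reprK. Qed.

Lemma gquot_mk_repr x : gcong (repr (gquot_mk x)) x.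
Proof. by apply/gquot_mkP; rewrite gquot_reprK. Qed.

Definition gquot_mul (x y : gquot_type) := gquot_mk (repr x * repr y).
Definition gquot_one := gquot_mk 1.
Definition gquot_inv (x : gquot_type) := gquot_mk (repr x)^-1.

Lemma gquot_mkM_subproof x y :
  gquot_mul (gquot_mk x) (gquot_mk y) = gquot_mk (x * y).
Proof. by apply/gquot_mkP/GCongMul; apply: gquot_mk_repr. Qed.

Lemma gquot_mulA : associative gquot_mul.
Proof.
move=> x y z; rewrite -(gquot_reprK x) -(gquot_reprK y) -(gquot_reprK z).
by rewrite !gquot_mkM_subproof mulgA.
Qed.
Lemma gquot_mul1 : left_id gquot_one gquot_mul.
Proof. by move=> x; rewrite -(gquot_reprK x) gquot_mkM_subproof mul1g. Qed.
Lemma gquot_1mul : right_id gquot_one gquot_mul.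
Proof. by move=> x; rewrite -(gquot_reprK x) gquot_mkM_subproof mulg1. Qed.
Lemma gquot_mulV : left_inverse gquot_one gquot_inv gquot_mul.
Proof.
by move=> x; rewrite -{2}(gquot_reprK x) gquot_mkM_subproof mulVg.
Qed.
Lemma gquot_Vmul : right_inverse gquot_one gquot_inv gquot_mul.
Proof.
by move=> x; rewrite -{1}(gquot_reprK x) gquot_mkM_subproof mulgV.
Qed.

HB.instance Definition _ := isGroup.Build gquot_type
  gquot_mulA gquot_mul1 gquot_1mul gquot_mulV gquot_Vmul.

Definition gquot : groupType := gquot_type.

Definition gquot_proj (x : G) : gquot := gquot_mk x.

Lemma gquot_projM : {morph gquot_proj : x y / x * y}.
Proof. by move=> x y; rewrite [RHS]gquot_mkM_subproof. Qed.

Lemma gquot_rel x y : R x y -> gquot_proj x = gquot_proj y.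
Proof. by move=> /GCongRel ?; apply/gquot_mkP. Qed.

Section Lift.
Variables (H : groupType) (f : G -> H).
Hypothesis fM : {morph f : x y / x * y}.
Hypothesis fR : forall x y, R x y -> f x = f y.

Definition gquot_lift (x : gquot) : H := f (repr x).

Lemma gquot_lift_proj x : gquot_lift (gquot_proj x) = f x.
Proof.
suff gcongf y z : gcong y z -> f y = f z by apply/gcongf/gquot_mk_repr.
elim=> {y z} [y z /fR|y|y z _ ->|x1 y z _ -> _ ->|x1 x2 y1 y2 _ IHx _ IHy] //.
by rewrite !fM IHx IHy.
Qed.

Lemma gquot_liftM : {morph gquot_lift : x y / x * y}.
Proof.
move=> x y; rewrite -(gquot_reprK x) -(gquot_reprK y).
rewrite -[LHS]/(gquot_lift (gquot_proj _ * gquot_proj _)) -gquot_projM.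
by rewrite !gquot_lift_proj fM.
Qed.

End Lift.

End GroupQuotient.

(* The cycle C_n has vertex set 'Z_n and edges {i, i + 1}; note that 'Z_n is
   Z/nZ only for n >= 2. *)
Definition cycle_adj n : rel 'Z_n :=
  fun i j => (j == (i + 1)%R) || (i == (j + 1)%R).

Definition cycle_symmetry n (s : {perm 'Z_n}) : bool :=
  [forall i, forall j, cycle_adj (s i) (s j) == cycle_adj i j].

Lemma cycle_symmetryP n (s : {perm 'Z_n}) :
  reflect (forall i j, cycle_adj (s i) (s j) = cycle_adj i j)
    (cycle_symmetry s).
Proof.
apply: (iffP forallP) => [h i j|h i]; first exact/eqP/(forallP (h i)).
by apply/forallP => j; apply/eqP.
Qed.

Section CyclicProduct.
Variables (n : nat) (G : 'Z_n -> groupType).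

Inductive cyclic_rel : free_prod G -> free_prod G -> Prop :=
| CyclicRel (i : 'Z_n) (g : G i) (h : G (i + 1)%R) :
    cyclic_rel (free_in g * free_in h) (free_in h * free_in g).

Definition cyclic_prod : groupType := gquot cyclic_rel.

Definition cyc_in i (g : G i) : cyclic_prod := gquot_proj _ (free_in g).

Lemma cyc_inM i : {morph @cyc_in i : g h / g * h}.
Proof. by move=> g h; rewrite /cyc_in free_inM gquot_projM. Qed.

Lemma cyc_inC i j (g : G i) (h : G j) :
  cycle_adj i j -> commute (cyc_in g) (cyc_in h).
Proof.
case/orP => /eqP e; first subst j; last subst i.
  by rewrite /commute -!gquot_projM; apply: gquot_rel; apply: CyclicRel.
by rewrite /commute -!gquot_projM; apply/esym/gquot_rel; apply: CyclicRel.
Qed.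

Lemma cyc_ind (P : cyclic_prod -> Prop) :
  P 1 -> (forall i (g : G i) x, P x -> P (cyc_in g * x)) -> forall x, P x.
Proof.
move=> P1 PM x; rewrite -(gquot_reprK x).
elim/free_ind: (repr x) => [|i g y IHy] //.
by rewrite [gquot_mk _ _]gquot_projM; apply: PM.
Qed.

Lemma cyc_morph_eq (H : groupType) (f f' : cyclic_prod -> H) :
  {morph f : x y / x * y} -> {morph f' : x y / x * y} ->
  (forall i (g : G i), f (cyc_in g) = f' (cyc_in g)) -> f =1 f'.
Proof.
move=> fM f'M e; elim/cyc_ind => [|i g x IHx]; first by rewrite !morph_one.
by rewrite fM f'M e IHx.
Qed.

Section Lift.
Variables (H : groupType) (f : forall i, G i -> H).
Hypothesis fM : forall i, {morph @f i : g h / g * h}.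
Hypothesis fC : forall i j (g : G i) (h : G j),
  cycle_adj i j -> commute (f g) (f h).

Definition cyc_lift : cyclic_prod -> H := gquot_lift (free_lift f).

Let relP x y : cyclic_rel x y -> free_lift f x = free_lift f y.
Proof.
case=> i g h; rewrite !(free_liftM fM) !(free_lift_in fM).
by apply: fC; rewrite /cycle_adj eqxx.
Qed.

Lemma cyc_liftM : {morph cyc_lift : x y / x * y}.
Proof. exact: gquot_liftM (free_liftM fM) relP. Qed.

Lemma cyc_lift_in i (g : G i) : cyc_lift (cyc_in g) = f g.
Proof.
by rewrite /cyc_lift (gquot_lift_proj (free_liftM fM) relP) free_lift_in.
Qed.

End Lift.

Definition Loc : set (gaut cyclic_prod) :=
  [set a | exists s : {perm 'Z_n}, cycle_symmetry s /\
     exists phi : forall i, giso (G i) (G (s i)),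
       forall i (g : G i), a (cyc_in g) = cyc_in (phi i g)]%classic.

Definition sym_pred (s : {perm 'Z_n}) : bool :=
  cycle_symmetry s && `[< forall i, isomorphic (G (s i)) (G i) >].

Record Sym := MkSym { sym_val :> {perm 'Z_n}; sym_valP : sym_pred sym_val }.

HB.instance Definition _ := [isSub for sym_val].
HB.instance Definition _ := [Choice of Sym by <:].

Lemma sym_adj (s : Sym) i j : cycle_adj (s i) (s j) = cycle_adj i j.
Proof. by case/andP: (sym_valP s) => /cycle_symmetryP. Qed.

Lemma sym_iso (s : Sym) i : isomorphic (G i) (G (s i)).
Proof.
case/andP: (sym_valP s) => _ /asboolP /(_ i) [f].
by exists; apply: giso_sym.
Qed.

(* In {perm 'Z_n} the product t * s is s \o t, whereas in Sym, which acts on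
   the left, the product s * t is s \o t. *)
Lemma sym_mul_subproof (s t : Sym) : sym_pred (sym_val t * sym_val s)%g.
Proof.
apply/andP; split.
  by apply/cycle_symmetryP => i j; rewrite !permM !sym_adj.
apply/asboolP => i; rewrite permM.
have [f] := sym_iso s (t i); have [g] := sym_iso t i.
by exists; apply/giso_sym/(giso_comp f g).
Qed.
Lemma sym_one_subproof : sym_pred 1%g.
Proof.
apply/andP; split; first by apply/cycle_symmetryP => i j; rewrite !perm1.
by apply/asboolP => i; rewrite perm1; exists; apply: giso_id.
Qed.
Lemma sym_inv_subproof (s : Sym) : sym_pred (sym_val s)^-1%g.
Proof.
apply/andP; split.
  by apply/cycle_symmetryP => i j; rewrite -(sym_adj s) !permKV.
apply/asboolP => i; have := sym_iso s ((sym_val s)^-1%g i).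
by rewrite permKV.
Qed.

Definition sym_mul (s t : Sym) := MkSym (sym_mul_subproof s t).
Definition sym_one := MkSym sym_one_subproof.
Definition sym_inv (s : Sym) := MkSym (sym_inv_subproof s).

Lemma sym_mulA : associative sym_mul.
Proof. by move=> s t u; apply: val_inj; rewrite /= mulgA. Qed.
Lemma sym_mul1 : left_id sym_one sym_mul.
Proof. by move=> s; apply: val_inj; rewrite /= mulg1. Qed.
Lemma sym_1mul : right_id sym_one sym_mul.
Proof. by move=> s; apply: val_inj; rewrite /= mul1g. Qed.
Lemma sym_mulV : left_inverse sym_one sym_inv sym_mul.
Proof. by move=> s; apply: val_inj; rewrite /= mulgV. Qed.
Lemma sym_Vmul : right_inverse sym_one sym_inv sym_mul.
Proof. by move=> s; apply: val_inj; rewrite /= mulVg. Qed.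

HB.instance Definition _ := isGroup.Build Sym
  sym_mulA sym_mul1 sym_1mul sym_mulV sym_Vmul.

Lemma symM (s t : Sym) i : (s * t) i = s (t i).
Proof. exact: permM. Qed.
Lemma sym1 i : (1 : Sym) i = i.
Proof. exact: perm1. Qed.
Lemma symK (s : Sym) i : s^-1 (s i) = i.
Proof. exact: permK. Qed.
Lemma symKV (s : Sym) i : s (s^-1 i) = i.
Proof. exact: permKV. Qed.

End CyclicProduct.

Arguments Loc {n} G.

(* A coherent choice of isomorphisms theta_(i, j) : G i -> G j, indexed by the
   pairs (i, j) such that G i and G j are isomorphic. *)
Record transport (I : Type) (G : I -> groupType) := Transport {
  theta : forall i j, isomorphic (G i) (G j) -> giso (G i) (G j);
  theta_id : forall i (h : isomorphic (G i) (G i)) g, theta h g = g;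
  theta_comp : forall i j k (hij : isomorphic (G i) (G j))
    (hjk : isomorphic (G j) (G k)) (hik : isomorphic (G i) (G k)) g,
    theta hjk (theta hij g) = theta hik g
}.

Lemma transport_exists (I : Type) (G : I -> groupType) :
  inhabited (transport G).
Proof.
have iso_eq i j : isomorphic (G i) (G j) ->
    (fun k => isomorphic (G i) (G k)) = (fun k => isomorphic (G j) (G k)).
  move=> [f]; apply: funext => k; apply: propext.
  split=> -[g]; exists; first exact: giso_comp g (giso_sym f).
  exact: giso_comp g f.
have ex (P : I -> Prop) : exists k : option I, forall i,
    P = (fun k => isomorphic (G i) (G k)) -> exists2 j, k = Some j & P j.
  have [[i Pi]|nP] := pselect (exists i, P i).
    by exists (Some i); exists i.
  exists None => i e; case: nP; exists i; rewrite e; exists; exact: giso_id.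
pose rep i := sval (cid (ex (fun k => isomorphic (G i) (G k)))).
have repP i : exists2 j, rep i = Some j & isomorphic (G i) (G j).
  by rewrite /rep; case: cid => k /= /(_ i erefl).
have rep_eq i j : isomorphic (G i) (G j) -> rep i = rep j.
  by move=> h; rewrite /rep (iso_eq _ _ h).
have [c _] : exists c : forall i j, rep i = Some j -> giso (G i) (G j), True.
  suff ci i j (e : rep i = Some j) : isomorphic (G i) (G j).
    have ci' i j (e : rep i = Some j) : exists f : giso (G i) (G j), True.
      by case: (ci i j e) => f; exists f.
    by exists (fun i j e => sval (cid (ci' i j e))).
  by case: (repP i) => k; rewrite e => -[->].
have [r rE] : exists r : I -> I, forall i, rep i = Some (r i).
  have r0 i : exists j, rep i = Some j by case: (repP i) => j; exists j.
  by exists (fun i => sval (cid (r0 i))) => i; case: cid.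
have e i j : isomorphic (G i) (G j) -> rep j = Some (r i).
  by move=> h; rewrite -(rep_eq _ _ h).
exists; unshelve eapply (@Transport I G (fun i j h =>
  giso_comp (giso_sym (c j (r i) (e i j h))) (c i (r i) (rE i)))).
- move=> i h g /=; rewrite (Prop_irrelevance (e i i h) (rE i)).
  exact: gisoK.
- move=> i j k hij hjk hik g /=.
  move: (e j k hjk) (e i k hik) (e i j hij) (rE j) (rE i).
  have rji : r j = r i.
    by have := rE j; rewrite -(rep_eq _ _ hij) rE => -[].
  rewrite {}rji => p1 p2 p3 p4 p5.
  by rewrite (Prop_irrelevance p3 p4) gisoKV (Prop_irrelevance p1 p2).
Qed.

Section LocalAction.
Variables (n : nat) (G : 'Z_n -> groupType) (th : transport G).

Lemma sym_iso_pred (s : Sym G) j : isomorphic (G (s^-1 j)) (G j).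
Proof. by have := sym_iso s (s^-1 j); rewrite symKV. Qed.

Definition prod_gaut : groupType := gprod (fun i => gaut (G i)).

(* This is (s . a)_(s i) = theta_(i, s i) o a_i o theta_(i, s i)^-1, written at
   j = s i so as to avoid a cast; see sym_actE. *)
Definition sym_act_fun (s : Sym G) (a : prod_gaut) : prod_gaut := fun j =>
  let t := theta th (sym_iso_pred s j) in
  giso_comp t (giso_comp (a (s^-1 j)) (giso_sym t)).

Lemma thetaK i j (h : isomorphic (G i) (G j)) (h' : isomorphic (G j) (G i)) :
  giso_inv (theta th h) =1 theta th h'.
Proof.
move=> g; apply: (can_inj (gisoK (theta th h))); rewrite gisoKV.
by rewrite (theta_comp th _ _ (inhabits (giso_id _))) theta_id.
Qed.

Lemma sym_act_funE (s : Sym G) (a : prod_gaut) i j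
    (h : isomorphic (G i) (G j)) : j = s i ->
  forall g, sym_act_fun s a j g = theta th h (a i (giso_inv (theta th h) g)).
Proof.
move=> ej g; have ei : s^-1 j = i by rewrite ej symK.
rewrite /sym_act_fun /=; move: (sym_iso_pred s j); rewrite ei => h'.
by rewrite (Prop_irrelevance h' h).
Qed.

Lemma sym_actE (s : Sym G) (a : prod_gaut) i g :
  sym_act_fun s a (s i) g =
    theta th (sym_iso s i) (a i (giso_inv (theta th (sym_iso s i)) g)).
Proof. exact: sym_act_funE. Qed.

Lemma prod_gaut_ext (a b : prod_gaut) : (forall i, a i =1 b i) -> a = b.
Proof.
by move=> e; apply: functional_extensionality_dep => i; apply/giso_ext/e.
Qed.

Lemma sym_act_funMr (s : Sym G) : {morph sym_act_fun s : a b / a * b}.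
Proof.
by move=> a b; apply: prod_gaut_ext => j g /=; rewrite gisoK.
Qed.

Lemma sym_act_fun1 a : sym_act_fun 1 a = a.
Proof.
apply: prod_gaut_ext => i g.
rewrite (@sym_act_funE 1 a i i (inhabits (giso_id _))) ?sym1 //.
by rewrite theta_id (thetaK _ (inhabits (giso_id _))) theta_id.
Qed.

Lemma sym_act_funM (s t : Sym G) a :
  sym_act_fun (s * t) a = sym_act_fun s (sym_act_fun t a).
Proof.
apply: prod_gaut_ext => j g.
pose i := t^-1 (s^-1 j).
have ej : j = s (t i) by rewrite /i !symKV.
clearbody i; subst j.
have hi := sym_iso t i; have hti := sym_iso s (t i).
have hsti : isomorphic (G i) (G (s (t i))) by rewrite -symM; apply: sym_iso.
rewrite (sym_act_funE a hsti) ?symM // (sym_act_funE _ hti) //.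
rewrite (sym_act_funE a hi) // (theta_comp th _ _ hsti).
congr (theta th hsti (a i _)).
apply: (can_inj (gisoK (theta th hsti))); rewrite gisoKV.
by rewrite -(theta_comp th hi hti hsti) !gisoKV.
Qed.

Lemma sym_actK (s : Sym G) : cancel (sym_act_fun s) (sym_act_fun s^-1).
Proof. by move=> a; rewrite -sym_act_funM mulVg sym_act_fun1. Qed.
Lemma sym_actKV (s : Sym G) : cancel (sym_act_fun s^-1) (sym_act_fun s).
Proof. by move=> a; rewrite -sym_act_funM mulgV sym_act_fun1. Qed.

Definition sym_act (s : Sym G) : gaut prod_gaut :=
  GIso (sym_act_funMr s) (sym_actK s) (sym_actKV s).

Lemma sym_actM : {morph sym_act : s t / s * t}.
Proof. by move=> s t; apply: giso_ext => a; apply: sym_act_funM. Qed.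

HB.instance Definition _ :=
  isMultiplicative.Build (Sym G) (gaut prod_gaut) sym_act sym_actM.

Definition loc_group : groupType := sdprod sym_act.

Definition loc_in (k : loc_group) i (g : G i) : cyclic_prod G :=
  cyc_in (k.1 (k.2 i) (theta th (sym_iso k.2 i) g)).

Lemma loc_inM k i : {morph @loc_in k i : g h / g * h}.
Proof. by move=> g h; rewrite /loc_in !gisoM cyc_inM. Qed.

Lemma loc_inC k i j (g : G i) (h : G j) :
  cycle_adj i j -> commute (loc_in k g) (loc_in k h).
Proof. by move=> ij; apply: cyc_inC; rewrite sym_adj. Qed.

(* For k = (a, s), the endomorphism that sends g in G i to
   a_(s i) (theta_(i, s i) g) in G (s i); see loc_act_in. *)
Definition loc_act_fun (k : loc_group) : cyclic_prod G -> cyclic_prod G :=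
  cyc_lift (@loc_in k).

Lemma loc_act_funMr k : {morph loc_act_fun k : x y / x * y}.
Proof. exact: cyc_liftM (@loc_inM k) (@loc_inC k). Qed.

Lemma loc_act_in k i (g : G i) :
  loc_act_fun k (cyc_in g) = cyc_in (k.1 (k.2 i) (theta th (sym_iso k.2 i) g)).
Proof. exact: (cyc_lift_in (@loc_inM k) (@loc_inC k)). Qed.

Lemma loc_act_fun1 : loc_act_fun 1 =1 id.
Proof.
apply: cyc_morph_eq => // [|i g]; first exact: loc_act_funMr.
rewrite loc_act_in /=; move: (sym_iso _ i); rewrite sym1 => h.
by rewrite theta_id.
Qed.

Lemma loc_act_funM k k' :
  loc_act_fun (k * k') =1 loc_act_fun k \o loc_act_fun k'.
Proof.
apply: cyc_morph_eq => [||i g]; first exact: loc_act_funMr.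
  by move=> x y /=; rewrite !loc_act_funMr.
rewrite /= !loc_act_in; case: k k' => [a s] [b t] /=.
suff e j (h : isomorphic (G i) (G j)) : j = s (t i) ->
    cyc_in ((a * sym_act_fun s b) j (theta th h g)) =
    cyc_in (a (s (t i)) (theta th (sym_iso s (t i))
      (b (t i) (theta th (sym_iso t i) g)))) by apply: e; apply: symM.
move=> ej; subst j; congr (cyc_in (a _ _)); rewrite -/(sym_act_fun s b _ _).
rewrite sym_actE; congr (theta th _ (b _ _)).
apply: (can_inj (gisoK (theta th (sym_iso s (t i))))); rewrite gisoKV.
by rewrite (theta_comp th _ _ h).
Qed.

Lemma loc_actK k : cancel (loc_act_fun k) (loc_act_fun k^-1).
Proof. by move=> x; rewrite -[LHS]loc_act_funM mulVg loc_act_fun1. Qed.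
Lemma loc_actKV k : cancel (loc_act_fun k^-1) (loc_act_fun k).
Proof. by move=> x; rewrite -[LHS]loc_act_funM mulgV loc_act_fun1. Qed.

Definition loc_act (k : loc_group) : gaut (cyclic_prod G) :=
  GIso (loc_act_funMr k) (loc_actK k) (loc_actKV k).

Lemma loc_actM : {morph loc_act : k k' / k * k'}.
Proof. by move=> k k'; apply: giso_ext => x; apply: loc_act_funM. Qed.

HB.instance Definition _ := isMultiplicative.Build
  loc_group (gaut (cyclic_prod G)) loc_act loc_actM.

End LocalAction.

Arguments sym_act {n G} th s.
Arguments loc_act {n G} th k.

(* Main.v *)
Require Import Defs.
From mathcomp Require Import all_boot perm ssralg zmodp zify ring.
From mathcomp Require Import boolp classical_sets.

(* For a vertex i let S_i be the parabolic subgroup of the star of i, that is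
   G_i x (G_(i-1) * G_(i+1)).  The cosets x S_i are the walls of the group, seen
   as a graph in which g and g a are adjacent for a in some G_i, and the
   syllable c_i(x^-1 g) of G_i that can begin a reduced word of x^-1 g says in
   which sector of the wall x S_i the point g lies.

   An automorphism a maps S_i into a conjugate of some S_j: the factors G_i and
   G_(i-1) * G_(i+1) commute and the second one is not abelian, while an element
   that skewers walls of some type has a centralizer acting by translations on
   the sequence of these walls, so that commutators in this centralizer fix two
   walls of the same type, hence lie in a conjugate of a single vertex group
   because n >= 5.  The same holds for the inverse of a, so a permutes the
   conjugates of the S_i.  The conjugates of the G_i are the minimal nontrivial
   intersections of two of them, so a(G_i) = x_i G_(s i) x_i^-1.

   The walls J_i = x_i S_(s i) form a cycle, and those that are not adjacent to
   J_k lie in a single sector of J_k.  A point p that minimizes the sum of the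
   distances to the J_i lies in this sector for all k, since otherwise rotating
   p around J_k would bring it closer to them.  A ping-pong argument then computes
   the sector of J_k that contains a(g) p from the first syllables of g.  As a
   is surjective, each wall p S_u is one of the J_k, so the conjugate of a by p is
   local. *)

Set Implicit Arguments.
Unset Strict Implicit.
Unset Printing Implicit Defensive.

Local Open Scope group_scope.

(** * Normal forms *)

Section Pilings.
Variables (n : nat) (G : 'Z_n -> groupType).
Implicit Types (i j : 'Z_n) (p q : 'Z_n -> seq (option {i & G i})).

Lemma cycle_adj_sym : symmetric (@cycle_adj n).
Proof. by move=> i j; rewrite /cycle_adj orbC. Qed.

Lemma cycle_adj_irr : irreflexive (@cycle_adj n).
Proof.
move=> i; rewrite /cycle_adj orbb -[X in X == _]GRing.addr0.
by apply/eqP => /GRing.addrI /eqP; rewrite eq_sym GRing.oner_eq0.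
Qed.

(* A piling has one stack for each vertex: the stack of [i] records the
   syllables in [G i] of a word, and a blank for each syllable in a factor
   that does not commute with [G i].  Pilings are normal forms. *)
Definition pile := 'Z_n -> seq (option {i & G i}).

Definition top i p : G i :=
  if p i is Some l :: _ then tagged_as (letter (1 : G i)) l else 1.

Definition pile_push i (g : G i) p : pile := fun j =>
  if j == i then Some (letter g) :: p j
  else if cycle_adj i j then p j else None :: p j.

Definition pile_pop i p : pile := fun j =>
  if (j == i) || ~~ cycle_adj i j then behead (p j) else p j.

Definition pile_put i (g : G i) p : pile :=
  if g == 1 then p else pile_push g p.

Definition pile_strip i p : pile := if top i p == 1 then p else pile_pop i p.

Definition pile_act i (g : G i) p : pile :=
  pile_put (g * top i p) (pile_strip i p).

Inductive piling : pile -> Prop :=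
| PilingNil : piling (fun=> [::])
| PilingPush i (g : G i) p :
    piling p -> top i p = 1 -> g <> 1 -> piling (pile_push g p).

Lemma top_eq i p q : p i = q i -> top i p = top i q.
Proof. by rewrite /top => ->. Qed.

Lemma top_push i (g : G i) p : top i (pile_push g p) = g.
Proof.
rewrite /top /pile_push eqxx; exact: (@tagged_asE _ _ (letter (1 : G i)) g).
Qed.

Lemma push_adj i j (g : G i) p : cycle_adj i j -> pile_push g p j = p j.
Proof.
rewrite /pile_push => ij; case: eqP => [e|_]; last by rewrite ij.
by move: ij; rewrite e cycle_adj_irr.
Qed.

Lemma put_adj i j (g : G i) p : cycle_adj i j -> pile_put g p j = p j.
Proof. by rewrite /pile_put; case: eqP => // _; apply: push_adj. Qed.

Lemma top_push_adj i j (g : G i) p :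
  cycle_adj i j -> top j (pile_push g p) = top j p.
Proof. by move=> ij; apply: top_eq; apply: push_adj. Qed.

Lemma top_put_adj i j (g : G i) p :
  cycle_adj i j -> top j (pile_put g p) = top j p.
Proof. by move=> ij; apply: top_eq; apply: put_adj. Qed.

Lemma top_push_far i j (g : G i) p :
  j != i -> ~~ cycle_adj i j -> top j (pile_push g p) = 1.
Proof. by rewrite /top /pile_push => /negbTE -> /negbTE ->. Qed.

Lemma pushK i (g : G i) p : pile_pop i (pile_push g p) = p.
Proof.
apply: funext => j; rewrite /pile_pop /pile_push.
by case: eqP => //= _; case: cycle_adj.
Qed.

Lemma top_put i (g : G i) p : top i p = 1 -> top i (pile_put g p) = g.
Proof. by rewrite /pile_put; case: eqP => [->|_ _] //; apply: top_push. Qed.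

Lemma strip_put i (g : G i) p : top i p = 1 -> pile_strip i (pile_put g p) = p.
Proof.
move=> t1; rewrite /pile_strip top_put // /pile_put.
by case: eqP => // _; apply: pushK.
Qed.

Lemma put_comm i j (g : G i) (h : G j) p : cycle_adj i j ->
  pile_put g (pile_put h p) = pile_put h (pile_put g p).
Proof.
move=> ij; rewrite /pile_put; case: eqP => //; case: eqP => // _ _.
apply: funext => k; rewrite /pile_push.
case: (eqVneq k i) => [->|ki]; case: (eqVneq _ j) => [e|kj] //.
- by rewrite e cycle_adj_irr in ij.
- by rewrite cycle_adj_sym ij.
- by rewrite e ij.
- by case: cycle_adj; case: cycle_adj.
Qed.

(** Induction on the piling: the last pushed letter lies in [G i], or hides the stack of [i] under a
    blank, or belongs to a neighbour of [i], and then [put_comm] exchanges it with the top of this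
    stack. *)
Lemma stripP p : piling p -> forall i, piling (pile_strip i p) /\
  top i (pile_strip i p) = 1 /\ p = pile_put (top i p) (pile_strip i p).
Proof.
elim=> [|j g q Rq IHq tq g1] i.
  by rewrite /pile_strip /top /= eqxx /pile_put eqxx; split=> //; constructor.
rewrite /pile_strip; case: (eqVneq (top i (pile_push g q)) 1) => [->|].
  by rewrite /pile_put eqxx; split; first exact: PilingPush.
case: (eqVneq i j) => [e|ij].
  by subst j; rewrite pushK /pile_put top_push => /negbTE ->.
case aij: (cycle_adj j i); last by rewrite top_push_far ?aij ?eqxx.
rewrite top_push_adj // => /eqP ti.
have [] := IHq i; rewrite /pile_strip (negbTE (introN eqP ti)).
move=> Rq' [tq' Eq]; set q' := pile_pop i q in Rq' tq' Eq *.
have eqp : pile_push g q = pile_put (top i q) (pile_push g q').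
  have := @put_comm j i g (top i q) q' aij.
  by rewrite -Eq /pile_put (introF eqP g1).
have -> : pile_pop i (pile_push g q) = pile_push g q'.
  by rewrite {1}eqp /pile_put (introF eqP ti) pushK.
rewrite top_push_adj //; split=> //; apply: PilingPush => //.
by rewrite -tq Eq; apply/esym/top_put_adj; rewrite cycle_adj_sym.
Qed.

Lemma put_piling i (g : G i) p : piling p -> top i p = 1 ->
  piling (pile_put g p).
Proof. by move=> Rp tp; rewrite /pile_put; case: eqP => //; constructor. Qed.

Lemma act_put i (g h : G i) p : top i p = 1 ->
  pile_act g (pile_put h p) = pile_put (g * h) p.
Proof. by move=> tp; rewrite /pile_act top_put // strip_put. Qed.

Lemma act_piling i (g : G i) p : piling p -> piling (pile_act g p).
Proof. by case/stripP/(_ i) => Rp [tp _]; apply: put_piling. Qed.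

Lemma top_act i (g : G i) p : piling p -> top i (pile_act g p) = g * top i p.
Proof. by case/stripP/(_ i) => Rp [tp _]; rewrite top_put. Qed.

Lemma act1 i p : piling p -> pile_act (1 : G i) p = p.
Proof. by case/stripP/(_ i) => Rp [tp]; rewrite /pile_act mul1g. Qed.

Lemma actM i (g h : G i) p : piling p ->
  pile_act g (pile_act h p) = pile_act (g * h) p.
Proof.
by case/stripP/(_ i) => Rp [tp ->]; rewrite !act_put ?mulgA.
Qed.

Lemma act_adj i j (g : G i) p : cycle_adj i j -> piling p ->
  pile_act g p j = p j.
Proof.
by move=> ij /stripP/(_ i) [_ [_ e]]; rewrite [in RHS]e /pile_act !put_adj.
Qed.

(** With [act1] and [actM], this makes the defining relations hold on pilings, so that the whole
    group acts on them. *)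
Lemma act_comm i j (g : G i) (h : G j) p : cycle_adj i j -> piling p ->
  pile_act g (pile_act h p) = pile_act h (pile_act g p).
Proof.
move=> ij /stripP/(_ i) [Rp [tp ->]].
move: Rp tp (top i p); set q := pile_strip i p => /stripP/(_ j) [Rq [tq ->]].
have ji : cycle_adj j i by rewrite cycle_adj_sym.
move: (top j q) Rq tq; move: (pile_strip j q) => {}q t Rq tq.
rewrite top_put_adj // => tqi s.
have tqj (u : G i) : top j (pile_put u q) = 1 by rewrite top_put_adj.
have tqi' (u : G j) : top i (pile_put u q) = 1 by rewrite top_put_adj.
rewrite (act_put g s (tqi' t)) !(put_comm _ t q ij) (act_put h t (tqj s)).
by rewrite -(put_comm _ _ _ ij) act_put // (act_put h t (tqj _)) put_comm.
Qed.

Definition pile_word (w : word G) p : pile :=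
  foldr (fun l => pile_act (tagged l)) p w.

Lemma pile_word_piling w p : piling p -> piling (pile_word w p).
Proof. by move=> Rp; elim: w => //= l w; apply: act_piling. Qed.

Lemma pile_word_eq u v : free_eq u v ->
  forall p, piling p -> pile_word u p = pile_word v p.
Proof.
elim=> {u v} [//|u v _ IH p Rp|u v w _ IHu _ IHv p Rp| |i p Rp|i g h p Rp].
- by rewrite IH.
- by rewrite IHu ?IHv.
- move=> u1 u2 v1 v2 _ IHu _ IHv p Rp; rewrite /pile_word !foldr_cat.
  by rewrite -!/(pile_word _ _) IHv // IHu //; apply: pile_word_piling.
- exact: act1.
- exact: actM.
Qed.

Definition pile_free (x : free_prod G) p : pile := pile_word (repr x) p.

Lemma pile_free_mk w p : piling p -> pile_free (free_mk w) p = pile_word w p.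
Proof. by apply: pile_word_eq; apply: free_mk_repr. Qed.

Lemma pile_free_piling x p : piling p -> piling (pile_free x p).
Proof. exact: pile_word_piling. Qed.

Lemma pile_freeM x y p : piling p ->
  pile_free (x * y) p = pile_free x (pile_free y p).
Proof.
move=> Rp; rewrite [x * y]/(free_mk (repr x ++ repr y)) pile_free_mk //.
by rewrite /pile_word foldr_cat.
Qed.

Lemma pile_free_in i (g : G i) p : piling p ->
  pile_free (free_in g) p = pile_act g p.
Proof. exact: pile_free_mk. Qed.

Lemma pile_free_gcong x y : gcong (@cyclic_rel n G) x y ->
  forall p, piling p -> pile_free x p = pile_free y p.
Proof.
elim=> {x y} [x y [i g h] p Rp|//|x y _ IH p Rp|x y z _ IHx _ IHy p Rp|].
- rewrite !pile_freeM // !pile_free_in //; try exact: act_piling.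
  by apply: act_comm => //; rewrite /cycle_adj eqxx.
- by rewrite IH.
- by rewrite IHx ?IHy.
- move=> x1 x2 y1 y2 _ IHx _ IHy p Rp; rewrite !pile_freeM // IHy //.
  by rewrite IHx //; apply: pile_free_piling.
Qed.

Definition nf (x : cyclic_prod G) : pile := pile_free (repr x) (fun=> [::]).

Lemma nf_piling x : piling (nf x).
Proof. by apply: pile_free_piling; constructor. Qed.

Lemma nf_mk x : nf (gquot_mk _ x) = pile_free x (fun=> [::]).
Proof. by apply: pile_free_gcong (PilingNil); apply: gquot_mk_repr. Qed.

Lemma nf1 : nf 1 = fun=> [::].
Proof.
rewrite [1 : cyclic_prod G]/(gquot_mk _ (free_mk [::])) nf_mk pile_free_mk //.
exact: PilingNil.
Qed.

Lemma nfM i (g : G i) x : nf (cyc_in g * x) = pile_act g (nf x).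
Proof.
rewrite -{1}(gquot_reprK x) -[gquot_mk _ _]/(gquot_proj _ _) -gquot_projM.
rewrite [gquot_proj _ _]/(gquot_mk _ _) nf_mk pile_freeM; last by constructor.
by rewrite pile_free_in; last exact: nf_piling.
Qed.

End Pilings.

(** * First syllables and syllable counts *)

Section Heads.
Variables (n : nat) (G : 'Z_n -> groupType).
Local Notation C := (cyclic_prod G).
Implicit Types (i j : 'Z_n) (x y : C).

(* The syllable in [G i] that a reduced word of [x] can start with, or [1]. *)
Definition lead i x : G i := top i (nf x).

(** Blanks are skipped, so this counts the syllables in [G i] of a reduced word of [x]. *)
Definition vlen i x := count isSome (nf x i).

Lemma lead1 i : lead i 1 = 1.
Proof. by rewrite /lead nf1. Qed.

Lemma leadM i (g : G i) x : lead i (cyc_in g * x) = g * lead i x.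
Proof. by rewrite /lead nfM top_act //; apply: nf_piling. Qed.

Lemma lead_adj i j (g : G i) x : cycle_adj i j ->
  lead j (cyc_in g * x) = lead j x.
Proof.
move=> ij; rewrite /lead nfM; apply: top_eq; apply: act_adj => //.
exact: nf_piling.
Qed.

Lemma lead_far i j (g : G i) x : j != i -> ~~ cycle_adj i j ->
  g * lead i x <> 1 -> lead j (cyc_in g * x) = 1.
Proof.
move=> ji aij g1; rewrite /lead nfM /pile_act /pile_put (introF eqP g1).
exact: top_push_far.
Qed.

Lemma vlen1 i : vlen i 1 = 0%N.
Proof. by rewrite /vlen nf1. Qed.

Lemma vlen_cons i j (g : G i) x : lead i x = 1 -> g <> 1 ->
  vlen j (cyc_in g * x) = ((i == j) + vlen j x)%N.
Proof.
move=> hx g1; rewrite /vlen nfM /pile_act /pile_put -/(lead i x) hx mulg1.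
rewrite (introF eqP g1) /pile_strip -/(lead i x) hx eqxx /pile_push eq_sym.
by case: eqP => //= _; case: cycle_adj.
Qed.

End Heads.

(** * Reduced products and parabolic subgroups *)

Section Reduced.
Variables (n : nat) (G : 'Z_n -> groupType).
Local Notation C := (cyclic_prod G).
Implicit Types (i j k : 'Z_n) (x y z : C) (I J : pred 'Z_n).

(* [mulgA] restated with the product of the group [C], so that [lia] identifies
   the lengths of the rewritten terms. *)
Lemma cycA x y z : x * (y * z) = x * y * z.
Proof. exact: mulgA. Qed.

Lemma cyc_in1 i : cyc_in (1 : G i) = 1.
Proof. exact: morph_one (@cyc_inM _ _ _). Qed.

Lemma cyc_inV i (g : G i) : cyc_in g^-1 = (cyc_in g)^-1.
Proof. exact: (morph_inv (@cyc_inM _ _ _)). Qed.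

Lemma lead_in i (g : G i) : lead i (cyc_in g) = g.
Proof. by rewrite -[cyc_in g]mulg1 leadM lead1 mulg1. Qed.

Inductive reduced : C -> Prop :=
| ReducedOne : reduced 1
| ReducedCons i (g : G i) x :
    reduced x -> lead i x = 1 -> g <> 1 -> reduced (cyc_in g * x).

Lemma reduced_strip x : reduced x ->
  forall i, reduced (cyc_in (lead i x)^-1 * x).
Proof.
elim=> [|j g y Ry IHy hy g1] i.
  by rewrite lead1 invg1 cyc_in1 mulg1; constructor.
have [eij|ij] := eqVneq i j.
  by subst i; rewrite leadM hy mulg1 cyc_inV mulKg.
case aij: (cycle_adj j i); last first.
  rewrite lead_far ?aij ?hy ?mulg1 // invg1 cyc_in1 mul1g.
  exact: ReducedCons.
rewrite lead_adj // mulgA (cyc_inC _ _ (_ : cycle_adj i j)).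
  rewrite -mulgA; apply: ReducedCons => //.
  by rewrite lead_adj // cycle_adj_sym.
by rewrite cycle_adj_sym.
Qed.

(** Strip the [G i] syllable of [x], merge it with [g], and put the result back unless it is [1].
    The induction principle [red_ind] then replaces any explicit choice of reduced words. *)
Lemma all_reduced x : reduced x.
Proof.
elim/cyc_ind: x => [|i g x Rx]; first exact: ReducedOne.
have := reduced_strip Rx i; set y := _ * x => Ry.
have hy : lead i y = 1 by rewrite leadM mulVg.
have -> : x = cyc_in (lead i x) * y by rewrite /y cyc_inV mulVKg.
rewrite mulgA -cyc_inM; case: (eqVneq (g * lead i x) 1) => [->|/eqP g1].
  by rewrite cyc_in1 mul1g.
exact: ReducedCons.
Qed.

Lemma red_ind (P : C -> Prop) : P 1 ->
  (forall i (g : G i) x, g <> 1 -> lead i x = 1 -> P x -> P (cyc_in g * x)) ->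
  forall x, P x.
Proof.
by move=> P1 PM x; elim: (all_reduced x) => // i g y _ Py hy g1; apply: PM.
Qed.

Lemma red_ind_r (P : C -> Prop) : P 1 ->
  (forall i (g : G i) x, g <> 1 -> lead i x^-1 = 1 -> P x ->
     P (x * cyc_in g)) ->
  forall x, P x.
Proof.
move=> P1 PM x; rewrite -[x]invgK.
elim/red_ind: x^-1 => [|i g y g1 hy Py]; first by rewrite invg1.
rewrite invgM -cyc_inV; apply: PM => //; last by rewrite invgK.
by move=> e; apply: g1; rewrite -[g]invgK e invg1.
Qed.

Lemma lead_eq1 x : (forall i, lead i x = 1) -> x = 1.
Proof.
elim/red_ind: x => // i g x g1 hx _ /(_ i).
by rewrite leadM hx mulg1.
Qed.

Lemma strip_ex i x : exists2 y, x = cyc_in (lead i x) * y & lead i y = 1.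
Proof.
exists (cyc_in (lead i x)^-1 * x); first by rewrite cyc_inV mulVKg.
by rewrite leadM mulVg.
Qed.

Lemma leads_adj i j x : lead i x <> 1 -> lead j x <> 1 ->
  (i == j) || cycle_adj i j.
Proof.
have [y {1 2}-> hy] := strip_ex i x.
rewrite leadM hy mulg1 => h1; have [//|ij] := eqVneq i j.
case: (boolP (cycle_adj i j)) => //= nij.
by rewrite lead_far // ?hy ?mulg1 // eq_sym.
Qed.

Lemma vlen_cons_gen i j (g : G j) x : lead j x = 1 ->
  vlen i (cyc_in g * x) = (((j == i) && (g != 1%g)) + vlen i x)%N.
Proof.
move=> hx; case: (eqVneq g 1) => [->|/eqP g1]; last first.
  by rewrite vlen_cons // andbT.
by rewrite cyc_in1 mul1g andbF.
Qed.

Lemma vlen_cons_le i j (g : G j) x :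
  (vlen i (cyc_in g * x) <= ((j == i) && (g != 1%g)) + vlen i x)%N.
Proof.
have [y ex hy] := strip_ex j x.
rewrite ex mulgA -cyc_inM !vlen_cons_gen // addnA leq_add2r.
case: eqP => // _ /=.
case: (eqVneq g 1) => [->|_] /=; first by rewrite mul1g.
by case: eqP.
Qed.

Lemma vlenM i x y : (vlen i (x * y) <= vlen i x + vlen i y)%N.
Proof.
elim/red_ind: x => [|j g x g1 hx IHx]; first by rewrite mul1g vlen1.
rewrite -mulgA (leq_trans (vlen_cons_le _ _ _)) //.
by rewrite vlen_cons_gen // -addnA leq_add2l.
Qed.

Lemma vlen_in i j (g : G j) : vlen i (cyc_in g) = (j == i) && (g != 1) :> nat.
Proof. by rewrite -[cyc_in g]mulg1 vlen_cons_gen ?lead1 // vlen1 addn0. Qed.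

Lemma vlenV i x : vlen i x^-1 = vlen i x.
Proof.
suff le y : (vlen i y^-1 <= vlen i y)%N.
  by apply/eqP; rewrite eqn_leq le -{1}[x]invgK le.
elim/red_ind: y => [|j g y g1 hy IHy]; first by rewrite invg1.
rewrite invgM -cyc_inV (leq_trans (vlenM _ _ _)) // vlen_in vlen_cons_gen //.
by rewrite addnC leq_add // invg_eq1.
Qed.

Lemma lead_vlen i x : lead i x <> 1 -> (0 < vlen i x)%N.
Proof.
have [y {2}-> hy] := strip_ex i x.
by move=> h1; rewrite vlen_cons // eqxx.
Qed.

Definition len x := (\sum_i vlen i x)%N.

Lemma len1 : len 1 = 0%N.
Proof. by rewrite /len big1 // => i _; apply: vlen1. Qed.

Lemma lenM x y : (len (x * y) <= len x + len y)%N.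
Proof. by rewrite /len -big_split /= leq_sum // => i _; apply: vlenM. Qed.

Lemma lenV x : len x^-1 = len x.
Proof. by apply: eq_bigr => i _; apply: vlenV. Qed.

Lemma len_cons i (g : G i) x : lead i x = 1 -> g <> 1 ->
  len (cyc_in g * x) = (len x).+1.
Proof.
move=> hx g1; rewrite /len (eq_bigr (fun j => (i == j) + vlen j x)%N).
  rewrite big_split /= (bigD1 i) //= eqxx big1 ?addn0 ?add1n //.
  by move=> j /negbTE; rewrite eq_sym => ->.
by move=> j _; rewrite vlen_cons.
Qed.

Lemma len_in i (g : G i) : (len (cyc_in g) <= 1)%N.
Proof.
case: (eqVneq g 1) => [->|/eqP g1]; first by rewrite cyc_in1 len1.
by rewrite -[cyc_in g]mulg1 len_cons ?lead1 // len1.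
Qed.

Lemma len_strip i x : lead i x <> 1 ->
  exists2 y, x = cyc_in (lead i x) * y & lead i y = 1 /\ len x = (len y).+1.
Proof.
move=> h1; have [y ex hy] := strip_ex i x; exists y => //; split=> //.
by rewrite ex len_cons.
Qed.

(** The product is reduced: no syllable of [x] cancels or merges with one of [y]. *)
Definition rdc x y := len (x * y) = (len x + len y)%N.

Lemma rdc_vlen x y i : rdc x y -> vlen i (x * y) = (vlen i x + vlen i y)%N.
Proof.
pose s z := (\sum_(j | j != i) vlen j z)%N.
have es z : len z = (vlen i z + s z)%N by rewrite /len (bigD1 i).
have : (s (x * y)%g <= s x + s y)%N.
  by rewrite -big_split /= leq_sum // => j _; apply: vlenM.
rewrite /rdc !es; have := vlenM i x y.
move: (s _) (s _) (s _) => *; lia.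
Qed.

Lemma rdcV x y : rdc x y -> rdc y^-1 x^-1.
Proof. by rewrite /rdc -invgM !lenV => ->; rewrite addnC. Qed.

Lemma rdcA x y z : rdc (x * y) z -> rdc x y -> rdc x (y * z) /\ rdc y z.
Proof.
rewrite /rdc -cycA.
have := lenM x (y * z); have := lenM y z => le1 le2 e1 e2; split; lia.
Qed.

Lemma rdc_cons i (g : G i) x : lead i x = 1 -> rdc (cyc_in g) x.
Proof.
move=> hx; rewrite /rdc; case: (eqVneq g 1) => [->|/eqP g1].
  by rewrite cyc_in1 mul1g len1.
by rewrite len_cons // -[cyc_in g]mulg1 len_cons ?lead1 // len1.
Qed.

(** The parabolic subgroup generated by the [G i] with [I i], encoded by supports so that its
    closure properties follow from the subadditivity of [vlen]. *)
Definition par I x := forall i, (0 < vlen i x)%N -> I i.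

Lemma par1 I : par I 1.
Proof. by move=> i; rewrite vlen1. Qed.

Lemma parM I x y : par I x -> par I y -> par I (x * y).
Proof.
move=> Ix Iy i v; have := vlenM i x y; case: (posnP (vlen i x)) => [e|/Ix //].
by move=> le; apply: Iy; lia.
Qed.

Lemma parV I x : par I x^-1 <-> par I x.
Proof. by split=> h i; have := h i; rewrite vlenV. Qed.

Lemma parMl I x y : par I x -> par I (x * y) -> par I y.
Proof. by move=> /parV Ix /(parM Ix); rewrite mulKg. Qed.

Lemma parJ I x y : par I y -> par I x -> par I (x ^ y).
Proof. by move=> Iy Ix; rewrite /conjg; do !apply: parM => //; apply/parV. Qed.

Lemma par_in I i (g : G i) : I i -> par I (cyc_in g).
Proof. by move=> Ii j; rewrite vlen_in; case: eqP => //= <-. Qed.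

Lemma par_sub I J x : (forall i, I i -> J i) -> par I x -> par J x.
Proof. by move=> s h i /h /s. Qed.

Lemma par_lead I x i : par I x -> ~~ I i -> lead i x = 1.
Proof. by move=> Ix nI; apply: contra_notP (negP nI) => /lead_vlen/Ix. Qed.

Lemma par_vlen I x i : par I x -> ~~ I i -> vlen i x = 0%N.
Proof.
by move=> Ix nI; case: (posnP (vlen i x)) => // /Ix; rewrite (negbTE nI).
Qed.

Lemma par_ind I (P : C -> Prop) : P 1 ->
  (forall i (g : G i) x, I i -> g <> 1 -> lead i x = 1 -> par I x -> P x ->
     P (cyc_in g * x)) ->
  forall x, par I x -> P x.
Proof.
move=> P1 PM x; elim/red_ind: x => // i g x g1 hx IHx Ix.
have Ii : I i by apply: Ix; rewrite vlen_cons ?eqxx.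
have Ix' : par I x by apply: parMl Ix; apply: par_in.
by apply: PM => //; apply: IHx.
Qed.

Lemma par_pred1 i x : par (pred1 i) x -> x = cyc_in (lead i x).
Proof.
move: x; apply: par_ind => [|j g x /eqP ej]; first by rewrite lead1 cyc_in1.
by subst j => _ hx _ ex; rewrite leadM hx mulg1 ex hx cyc_in1 mulg1.
Qed.

Lemma par_pred0 x : par pred0 x -> x = 1.
Proof. by move: x; apply: par_ind. Qed.

Lemma par_comm I J x y : (forall i j, I i -> J j -> cycle_adj i j) ->
  par I x -> par J y -> commute x y.
Proof.
move=> IJ; move: x; apply: par_ind => [_|i g x Ii _ _ _ IHx Jy].
  exact/commute_sym/commute1.
apply/commute_sym/commuteM; last by apply/commute_sym/IHx.
move: y Jy {IHx}; apply: par_ind => [|j h y Jj _ _ _ IHy].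
  exact/commute_sym/commute1.
by apply/commute_sym/commuteM; [apply: cyc_inC; apply: IJ|apply: commute_sym].
Qed.

Lemma link_comm i (g : G i) x : par (cycle_adj i) x -> commute (cyc_in g) x.
Proof.
apply: (@par_comm (pred1 i)); last exact/par_in/eqxx.
by move=> j k /eqP ->.
Qed.

Lemma lead_link i x y : par (cycle_adj i) x -> lead i (x * y) = lead i y.
Proof.
move: x; apply: par_ind => [|j g x ij _ _ _ IHx]; first by rewrite mul1g.
by rewrite -mulgA lead_adj // cycle_adj_sym.
Qed.

(** If a [G i] syllable were still available after removing that of [x], the two would merge and
    shorten the product. *)
Lemma lead_rdc x y i : rdc x y -> lead i x <> 1 -> lead i (x * y) = lead i x.
Proof.
move=> + /len_strip [x' ex [hx' lx]].
rewrite /rdc ex -cycA !leadM hx' mulg1 -ex => r.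
suff -> : lead i (x' * y) = 1 by rewrite mulg1.
case: (pselect (lead i (x' * y) = 1)) => // /len_strip [z ez [hz lz]].
move: r; rewrite {1}ez cycA -cyc_inM.
have := lenM (cyc_in (lead i x * lead i (x' * y))) z.
have := lenM x' y; have := len_in (lead i x * lead i (x' * y)); lia.
Qed.

(** As [x] does not start in [G i], a syllable of [x] outside the link of [i] keeps every [G i]
    syllable of [y] away from the front. *)
Lemma lead_rdc1 x y i : rdc x y -> lead i x = 1 -> ~ par (cycle_adj i) x ->
  lead i (x * y) = 1.
Proof.
elim/red_ind: x => [|j g x g1 hx IHx] r h np; first by case: np; apply: par1.
have [r1 r2] := rdcA r (rdc_cons g hx).
have [e|ij] := eqVneq i j; first by subst j; move: h; rewrite leadM hx mulg1.
rewrite -mulgA; case: (boolP (cycle_adj j i)) => aij.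
  rewrite lead_adj //; apply: IHx => //; first by rewrite -(lead_adj g x aij).
  move=> px; apply: np; apply: parM => //; apply: par_in.
  by rewrite cycle_adj_sym.
apply: lead_far => //; rewrite -leadM mulgA lead_rdc // leadM hx mulg1 //.
Qed.

(** A cancellation or a merger needs a vertex at which [x] ends and [y] starts. The induction passes
    the last letter of [x] over to [y]. *)
Lemma rdc_leads x y : (forall i, lead i x^-1 = 1 \/ lead i y = 1) -> rdc x y.
Proof.
elim/red_ind_r: x y => [|j g x g1 hx IHx] y hxy.
  by rewrite /rdc mul1g len1.
have hinv : g^-1 <> 1 by move=> e; apply: g1; rewrite -[g]invgK e invg1.
have ex : (x * cyc_in g)^-1 = cyc_in g^-1 * x^-1 by rewrite invgM cyc_inV.
have hy : lead j y = 1.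
  by case: (hxy j) => //; rewrite ex leadM hx mulg1 => /hinv.
have : rdc x (cyc_in g * y).
  apply: IHx => i; have [->|ij] := eqVneq i j; first by left.
  case: (boolP (cycle_adj j i)) => aij; last first.
    by right; apply: lead_far; rewrite // hy mulg1.
  by case: (hxy i); rewrite ?ex lead_adj //; [left|right].
rewrite /rdc -mulgA => ->; rewrite len_cons //.
have -> : len (x * cyc_in g) = (len x).+1 by rewrite -lenV ex len_cons ?lenV.
by rewrite addSnnS.
Qed.

Lemma coset_min I x : exists p y,
  [/\ x = p * y, par I p, forall i, I i -> lead i y = 1 & rdc p y].
Proof.
suff [p [y [-> pp hy]]] : exists p y,
    [/\ x = p * y, par I p & forall i, I i -> lead i y = 1].
  exists p, y; split=> //; apply: rdc_leads => i; case Ii: (I i).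
    by right; apply: hy.
  by left; apply: (@par_lead I); [apply/parV|rewrite Ii].
have [m] := ubnP (len x); elim: m x => // m IHm x lx.
have [h|/existsNP [i /not_implyP [Ii /len_strip [x' ex [_ lx']]]]] :=
  pselect (forall i, I i -> lead i x = 1).
  by exists 1, x; split=> //; [rewrite mul1g|apply: par1].
have [|p [y [ex' pp hy]]] := IHm x'; first by lia.
exists (cyc_in (lead i x) * p), y; split=> //; first by rewrite -mulgA -ex'.
by apply: parM => //; apply: par_in.
Qed.

(* [y] is the element of minimal length of a double coset of the parabolic
   subgroups of [I] and [J]. *)
Definition bireduced I J y :=
  (forall i, I i -> lead i y = 1) /\ (forall j, J j -> lead j y^-1 = 1).

(** Minimize on the left, then on the right. The second step keeps the first property, because the
    leads of a left factor survive in a reduced product. *)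
Lemma double_coset I J x : exists p y q,
  [/\ x = p * y * q, par I p, par J q & bireduced I J y].
Proof.
have [p [y0 [-> pp hy0 _]]] := coset_min I x.
have [q [y1 [ey pq hy1 r]]] := coset_min J y0^-1.
have ey0 : y0 = y1^-1 * q^-1 by rewrite -invgM -ey invgK.
exists p, y1^-1, q^-1; split=> //; first by rewrite ey0 mulgA.
  exact/parV.
split=> [i Ii|j Jj]; last by rewrite invgK; apply: hy1.
apply: contrapT => h; apply: (h).
by rewrite -(lead_rdc (rdcV r) h) -ey0; apply: hy0.
Qed.

Lemma bireducedV I J y : bireduced I J y -> bireduced J I y^-1.
Proof. by case=> h1 h2; split=> // i; rewrite invgK; apply: h1. Qed.

Lemma bireduced_rdc I J y q : bireduced I J y -> par J q -> rdc y q.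
Proof.
move=> [_ hy] Jq; apply: rdc_leads => i; case Ji: (J i).
  by left; apply: hy.
by right; apply: par_lead Jq _; rewrite Ji.
Qed.

(** Peel off the first letter [g] of [p]. It must start [y * q], but [y] starts at no vertex of [I],
    so [g] comes from [q] and has crossed [y], which forces [y] into the link of its vertex. *)
Lemma par_conj I J y p q : bireduced I J y -> par I p -> par J q ->
  p * y = y * q ->
  p = q /\ forall i, (0 < vlen i p)%N -> [/\ I i, J i & par (cycle_adj i) y].
Proof.
move=> By Ip; move: p Ip q; apply: par_ind => [|i g p Ii g1 hp Ip IHp] q Jq.
  rewrite mul1g -{1}[y]mulg1 => /mulgI <-; split=> // i.
  by rewrite vlen1.
move=> e; have r := bireduced_rdc By Jq.
have hi : lead i (y * q) = g.
  rewrite -e -mulgA leadM -{2}[g]mulg1; congr (_ * _).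
  have rp : rdc (cyc_in g * p) y.
    have := rdcV (bireduced_rdc (bireducedV By) (_ : par I (cyc_in g * p)^-1)).
    by rewrite !invgK; apply; apply/parV/parM => //; apply: par_in.
  apply: (mulgI g); rewrite -leadM mulgA lead_rdc // leadM hp mulg1 //.
have hy : lead i y = 1 by case: By => + _; apply.
have Ly : par (cycle_adj i) y.
  by apply: contra_notP g1 => np; rewrite -hi lead_rdc1.
have hq : lead i q = g by rewrite -hi lead_link.
have Ji : J i by apply: Jq; apply: lead_vlen; rewrite hq.
have [q' eq' hq'] := strip_ex i q; rewrite hq in eq'.
have Jq' : par J q'.
  by apply: (@parMl _ (cyc_in g)); rewrite -?eq' //; apply: par_in.
have [|e' h] := IHp q' Jq'.
  apply: (mulgI (cyc_in g)).
  by rewrite mulgA e eq' !mulgA (link_comm g Ly).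
rewrite eq' -e'; split=> // j; rewrite vlen_cons //.
by have [<- _|_] := eqVneq i j; [|apply: h].
Qed.

(** * Retractions onto the vertex groups *)

Definition ret_letter i j (g : G j) : G i :=
  tagged_as (letter (1 : G i)) (letter g).

Lemma ret_letter_id i (g : G i) : ret_letter i g = g.
Proof. exact: (@tagged_asE _ _ (letter (1 : G i)) g). Qed.

Lemma ret_letter_neq i j (g : G j) : j != i -> ret_letter i g = 1.
Proof.
rewrite /ret_letter /tagged_as /=; case: eqP => // e.
by case/eqP; apply: esym e.
Qed.

Lemma ret_letterM i j : {morph (@ret_letter i j) : g h / g * h}.
Proof.
move=> g h; have [e|ji] := eqVneq j i; first by subst j; rewrite !ret_letter_id.
by rewrite !ret_letter_neq // mulg1.
Qed.

Lemma ret_letterC i j k (g : G j) (h : G k) : cycle_adj j k ->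
  commute (ret_letter i g) (ret_letter i h).
Proof.
move=> jk; have [e|ji] := eqVneq j i; last first.
  by rewrite [ret_letter i g]ret_letter_neq //; apply/commute_sym/commute1.
have [e'|ki] := eqVneq k i; last first.
  by rewrite [ret_letter i h]ret_letter_neq //; apply/commute1.
by subst j k; rewrite cycle_adj_irr in jk.
Qed.

Definition ret i : C -> G i := cyc_lift (@ret_letter i).

Lemma retM i : {morph @ret i : x y / x * y}.
Proof. exact: cyc_liftM (@ret_letterM i) (@ret_letterC i). Qed.

Lemma ret1 i : ret i 1 = 1. Proof. exact: morph_one (@retM i). Qed.

Lemma retV i : {morph @ret i : x / x^-1}.
Proof. exact: morph_inv (@retM i). Qed.

Lemma ret_in i (g : G i) : ret i (cyc_in g) = g.
Proof.
rewrite /ret (cyc_lift_in (@ret_letterM i) (@ret_letterC i)).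
exact: ret_letter_id.
Qed.

Lemma ret_in_neq i j (g : G j) : j != i -> ret i (cyc_in g) = 1.
Proof.
rewrite /ret (cyc_lift_in (@ret_letterM i) (@ret_letterC i)).
exact: ret_letter_neq.
Qed.

Lemma retJ i x y : ret i (x ^ y) = ret i x ^ ret i y.
Proof. by rewrite /conjg !retM retV. Qed.

Lemma par_ret I i x : par I x -> ~~ I i -> ret i x = 1.
Proof.
move=> + nI; move: x; apply: par_ind => [|j g x Ij _ _ _ IHx].
  exact: ret1.
by rewrite retM IHx mulg1 ret_in_neq //; apply: contraNneq nI => <-.
Qed.

Lemma ret_vlen i x : ret i x <> 1 -> (0 < vlen i x)%N.
Proof.
case: posnP => // v0; case; apply: (@par_ret (fun j => j != i)); last first.
  by rewrite eqxx.
by move=> j; apply: contraTneq => ->; rewrite v0.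
Qed.

Lemma cyc_in_inj i : injective (@cyc_in n G i).
Proof. exact: can_inj (@ret_in i). Qed.

Lemma cyc_in_neq1 i (g : G i) : g <> 1 -> cyc_in g <> 1.
Proof. by move=> g1; rewrite -(cyc_in1 i) => /cyc_in_inj. Qed.

End Reduced.

(** * The cycle *)

Section Cycle.
Variable n : nat.
Hypothesis n_ge5 : (5 <= n)%N.
Implicit Types i j k l u v : 'Z_n.

Definition star i : pred 'Z_n := fun j => (i == j) || cycle_adj i j.

Lemma starxx i : star i i. Proof. by rewrite /star eqxx. Qed.

Lemma star_sym i j : star i j = star j i.
Proof. by rewrite /star eq_sym cycle_adj_sym. Qed.

Lemma adj_star i j : cycle_adj i j -> star i j.
Proof. by rewrite /star => ->; rewrite orbT. Qed.

Lemma star_adj i j : i != j -> star i j = cycle_adj i j.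
Proof. by rewrite /star => /negbTE ->. Qed.

(** The bound on [n] excludes triangles and squares here: [zn] reduces an impossible coincidence of
    vertices to this statement. *)
Lemma natZn_neq0 m : (0 < m < 5)%N -> m%:R%R <> 0%R :> 'Z_n.
Proof.
move=> m5 /(congr1 val); rewrite /= val_Zp_nat; last by lia.
by rewrite modn_small; lia.
Qed.

Lemma adjP i j : cycle_adj i j -> j = (i + 1)%R \/ j = (i - 1)%R.
Proof.
by case/orP => /eqP ->; [left|right]; rewrite ?GRing.addrK.
Qed.

Lemma adj_succ i : cycle_adj i (i + 1)%R.
Proof. by rewrite /cycle_adj eqxx. Qed.

Lemma adj_pred i : cycle_adj (i - 1)%R i.
Proof. by rewrite /cycle_adj GRing.subrK eqxx. Qed.

Lemma Zn_absurd m i j : (0 < m < 5)%N -> i = j ->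
  (i - j = m%:R \/ j - i = m%:R)%R -> False.
Proof.
by move=> m5 -> [] /esym; rewrite GRing.subrr; apply: natZn_neq0.
Qed.

Ltac zn e := solve
  [ apply: (Zn_absurd (m := 1) isT e); (left; ring) || (right; ring)
  | apply: (Zn_absurd (m := 2) isT e); (left; ring) || (right; ring)
  | apply: (Zn_absurd (m := 3) isT e); (left; ring) || (right; ring)
  | apply: (Zn_absurd (m := 4) isT e); (left; ring) || (right; ring) ].

Lemma no_triangle i j k :
  cycle_adj i j -> cycle_adj j k -> cycle_adj i k -> False.
Proof.
by move=> /adjP[->|->] /adjP[->|->] /adjP[] e; zn e.
Qed.

(** Two different common neighbours of [v] and [u] would form a square in the cycle. *)
Lemma adj_star_uniq v u j k : ~~ star v u ->
  star v j -> star v k -> cycle_adj j u -> cycle_adj k u -> j = k.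
Proof.
move=> vu vj vk ju ku.
have {vj} /adjP vj : cycle_adj v j.
  by rewrite -star_adj //; apply: contraNneq vu => ->; exact: adj_star.
have {vk} /adjP vk : cycle_adj v k.
  by rewrite -star_adj //; apply: contraNneq vu => ->; exact: adj_star.
have {vu} /eqP vu : v != u by apply: contraNneq vu => ->; apply: starxx.
move: ju ku => /adjP ju /adjP; case: ju => eu; case: vj => ej; subst u j.
- by case: vk => ek; subst k => // -[] e; exfalso; zn e.
- by case: vu; ring.
- by case: vu; ring.
- by case: vk => ek; subst k => // -[] e; exfalso; zn e.
Qed.

Lemma star_cap_edge j k : j != k ->
  exists l, forall m, star j m -> star k m -> (m == l) || (m == l + 1)%R.
Proof.
move=> jk; have [ajk|njk] := boolP (star j k); last first.
  have [[m [jm km]]|no] := pselect (exists m, star j m /\ star k m); last first.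
    by exists j => m jm km; case: no; exists m.
  have adj m' : star j m' -> star k m' -> cycle_adj m' k.
    rewrite star_sym => jm' km'; rewrite -star_adj ?[star m' k]star_sym //.
    by apply: contraNneq njk => <-; rewrite star_sym.
  exists m => m' jm' km'; apply/orP; left; apply/eqP.
  by apply: (adj_star_uniq njk) => //; apply: adj.
rewrite star_adj // in ajk; case/orP: ajk => /eqP e; subst; [exists j|exists k].
all: move=> m /orP[/eqP<-|/adjP[]->] /orP[/eqP e|/adjP[] e].
all: rewrite ?GRing.addrK ?eqxx ?orbT //.
all: exfalso; zn e.
Qed.

Lemma clique_edge (K : pred 'Z_n) : (forall i j, K i -> K j -> star i j) ->
  exists l, forall m, K m -> (m == l) || (m == l + 1)%R.
Proof.
move=> cK; have [[a Ka]|no] := pselect (exists a, K a); last first.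
  by exists 0%R => m Km; case: no; exists m.
have [[b [Kb ab]]|no] := pselect (exists b, K b /\ a != b); last first.
  exists a => m Km; case: eqVneq => //= am; case: no; exists m.
  by rewrite eq_sym.
have := cK a b Ka Kb; rewrite star_adj // => aab.
have h m : K m -> (m == a) || (m == b).
  move=> Km; case: eqVneq => //= ma; case: eqVneq => // mb; exfalso.
  apply: (no_triangle aab (_ : cycle_adj b m)).
    by rewrite -star_adj ?cK // eq_sym.
  by rewrite -star_adj ?cK // eq_sym.
case/orP: aab => /eqP e; subst; [by exists a|exists b => m /h].
by rewrite orbC.
Qed.

Lemma pred_succ_nstar i : ~~ star (i - 1)%R (i + 1)%R.
Proof. by apply/negP => /orP[/eqP e|/adjP[] e]; zn e. Qed.

Lemma pred_succ_star i j : star (i - 1)%R j -> star (i + 1)%R j -> j = i.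
Proof.
move=> ij ij'; apply: (adj_star_uniq (pred_succ_nstar i)) => //.
- exact/adj_star/adj_pred.
- rewrite -star_adj 1?star_sym //.
  by apply: contraNneq (pred_succ_nstar i) => <-.
- exact: adj_succ.
Qed.

Lemma not_all_star j : exists i, ~~ star i j.
Proof.
by exists (j + 1 + 1)%R; apply/negP => /orP[/eqP e|/adjP[] e]; zn e.
Qed.

(* The vertices at distance at least 2 from [k] form a path. *)
Lemma far_connected k (P : 'Z_n -> Prop) :
  (forall i, ~~ star k i -> ~~ star k (i + 1)%R -> (P i <-> P (i + 1)%R)) ->
  forall i j, ~~ star k i -> ~~ star k j -> P i -> P j.
Proof.
(* Walking around the cycle from [k], the vertices outside the star of [k] are [a 2], ...,
   [a (n - 2)]. *)
move=> hP; pose a m := (k + m%:R)%R.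
have n1 : (1 < n)%N by lia.
have aS m : a m.+1 = (a m + 1)%R by rewrite /a -GRing.natr1 GRing.addrA.
have zr m : (m <= n)%N -> m%:R%R = 0%R :> 'Z_n -> m = 0%N \/ m = n.
  rewrite leq_eqVlt => /orP[/eqP|mn]; first by right.
  by move=> /(congr1 val); rewrite /= val_Zp_nat // modn_small; auto.
have aP m : (1 < m < n.-1)%N -> ~~ star k (a m).
  move=> mn; apply/negP => /orP[/eqP|/adjP[]]; rewrite /a => e.
  - have e0 : m%:R%R = 0%R :> 'Z_n.
      by apply: (@GRing.addrI _ k); rewrite GRing.addr0 -e.
    by case: (zr _ _ e0); lia.
  - have e0 : m.-1%:R%R = 0%R :> 'Z_n.
      apply: (@GRing.addrI _ (k + 1)%R); rewrite GRing.addr0 -{2}e.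
      by rewrite -GRing.addrA GRing.nat1r prednK //; lia.
    by case: (zr _ _ e0); lia.
  - have e0 : m.+1%:R%R = 0%R :> 'Z_n.
      apply: (@GRing.addrI _ k); rewrite GRing.addr0 -GRing.natr1.
      by rewrite GRing.addrA e GRing.subrK.
    by case: (zr _ _ e0); lia.
have Pa m : (1 < m < n.-1)%N -> P (a 2) <-> P (a m).
  elim: m => // m IHm mn; have [->//|m1] := eqVneq m 1%N.
  rewrite (aS m) -(hP (a m)) -?aS; try by apply: aP; lia.
  by apply: IHm; lia.
have aE i : ~~ star k i -> exists2 m, (1 < m < n.-1)%N & i = a m.
  have [m lt ei] : exists2 m, (m < n)%N & i = a m.
    exists (val (i - k)%R); last by rewrite /a natr_Zp GRing.addrC GRing.subrK.
    by have := ltn_ord (i - k)%R; rewrite [X in (_ < X)%N]Zp_cast.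
  move=> ki; exists m => //; case: m lt ei => [|[|m]] lt ei.
  - by case/negP: ki; rewrite ei /a GRing.addr0 starxx.
  - by case/negP: ki; rewrite ei /a adj_star ?adj_succ.
  - have [em|/eqP em] := eqVneq m.+3 n; last by lia.
    case/negP: ki; apply: adj_star; rewrite cycle_adj_sym ei /a.
    suff {2}-> : k = (k + m.+2%:R + 1)%R by rewrite adj_succ.
    by rewrite -GRing.addrA GRing.natr1 em pchar_Zp // GRing.addr0.
move=> i j /aE[m hm ->] /aE[m' hm' ->].
by rewrite -(Pa m) // -(Pa m').
Qed.

End Cycle.

(** * Stars and sectors *)

Section Stars.
Variables (n : nat) (G : 'Z_n -> groupType).
Hypothesis n_ge5 : (5 <= n)%N.
Local Notation C := (cyclic_prod G).
Implicit Types (i j k l u v w : 'Z_n) (x y z p q g h s t : C) (I J : pred 'Z_n).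

Lemma vlen_ex x : x <> 1 -> exists i, (0 < vlen i x)%N.
Proof.
move=> x1; apply: contrapT => no; apply: x1; apply: (@par_pred0 n G) => i v0.
by case: no; exists i.
Qed.

Lemma lead_ex x : x <> 1 -> exists i, lead i x <> 1.
Proof.
move=> x1; apply: contrapT => no; apply: x1; apply: lead_eq1 => i.
by apply: contrapT => h; apply: no; exists i.
Qed.

Lemma link_star i x : par (cycle_adj i) x -> par (star i) x.
Proof. by apply: par_sub => j; apply: adj_star. Qed.

Lemma vertex_star i x : par (pred1 i) x -> par (star i) x.
Proof. by apply: par_sub => j /eqP ->; apply: starxx. Qed.

Lemma par_star_in i (a : G i) : par (star i) (cyc_in a).
Proof. exact/par_in/starxx. Qed.

Lemma star_split i x : par (star i) x ->
  exists2 l, par (cycle_adj i) l & x = cyc_in (lead i x) * l.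
Proof.
move=> ix; suff [a [l Ll ->]] :
    exists a : G i, exists2 l, par (cycle_adj i) l & x = cyc_in a * l.
  by exists l; rewrite // leadM -[l]mulg1 lead_link // lead1 !mulg1.
move: x ix; apply: par_ind => [|j g x].
  by exists 1, 1; rewrite ?cyc_in1 ?mulg1 //; apply: par1.
move=> ij _ _ _ [a [l Ll ->]]; have [e|nij] := eqVneq i j.
  by subst j; exists (g * a), l; rewrite // cyc_inM mulgA.
rewrite star_adj // in ij; exists a, (cyc_in g * l).
  by apply: parM => //; apply: par_in.
by rewrite !mulgA (cyc_inC a g ij).
Qed.

(** On this subgroup, the direct product of [G i] and the link, [lead i] is the projection to
    [G i]. *)
Lemma lead_star i p x : par (star i) p ->
  lead i (p * x) = lead i p * lead i x.
Proof.
by move=> /star_split[l Ll {1}->]; rewrite -mulgA leadM lead_link.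
Qed.

Lemma lead_starV i p : par (star i) p -> lead i p^-1 = (lead i p)^-1.
Proof.
move=> ip; apply: (mulgI (lead i p)).
by rewrite -lead_star // !mulgV lead1.
Qed.

(** [par_conj] for a conjugator split along its double coset. The facts below on intersections of
    conjugates are read off from it. *)
Lemma par_conj_double I J p y q z : bireduced I J y ->
  par I p -> par J q -> par I z -> par J (z ^ (p * y * q)) ->
  forall i, (0 < vlen i (z ^ p))%N -> [/\ I i, J i & par (cycle_adj i) y].
Proof.
move=> By Ip Jq Iz Jz.
have e : z ^ p * y = y * (z ^ (p * y * q)) ^ q^-1.
  by rewrite -conjgM mulgK conjgM -conjgC.
have [||//] := par_conj By _ _ e; first exact: parJ.
by apply: parJ => //; apply/parV.
Qed.

Lemma conjg_neq1 z x : z <> 1 -> z ^ x <> 1.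
Proof. by move=> z1 /eqP; rewrite conjg_eq1 => /eqP. Qed.
Arguments conjg_neq1 {z} x _ _.

(** For single vertices the common support can only be [v = w], so the minimal representative lies
    in the link of [v] and the two outer factors lie in [G v]. *)
Lemma conj_vertex v w (a : G v) (b : G w) g : a <> 1 ->
  cyc_in a ^ g = cyc_in b -> v = w /\ par (star v) g.
Proof.
move=> a1 e.
have [p [y [q [eg Ip Jq By]]]] := double_coset (pred1 v) (pred1 w) g.
subst g; have [i hi] := vlen_ex (conjg_neq1 p (cyc_in_neq1 a1)).
have [||/eqP ? /eqP ? Ly] := par_conj_double By Ip Jq _ _ hi.
- exact/par_in/eqxx.
- by rewrite e; apply/par_in/eqxx.
subst i w; split=> //; do !apply: parM; first exact: vertex_star.
  exact: link_star.
exact: vertex_star.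
Qed.

Lemma cent_vertex v (a : G v) g : a <> 1 -> commute (cyc_in a) g ->
  par (star v) g.
Proof.
by move=> a1 /commgP /conjg_fixP e; have [] := conj_vertex a1 e.
Qed.

Lemma star_meet v w (b : G w) h : b <> 1 -> par (star v) (cyc_in b ^ h^-1) ->
  star v w /\ exists p s, [/\ par (star v) p, par (star w) s & h = p * s].
Proof.
move=> b1 Sb.
have [p [y [q [eh Ip Jq By]]]] := double_coset (star v) (pred1 w) h.
have [i hi] := vlen_ex (conjg_neq1 p (conjg_neq1 h^-1 (cyc_in_neq1 b1))).
have [|vi /eqP ? Ly] := par_conj_double By Ip Jq Sb _ hi.
  by rewrite -eh conjgKV; apply/par_in/eqxx.
subst i; split=> //; exists p, (y * q); split=> //; last by rewrite mulgA.
by apply: parM; [apply: link_star|apply: vertex_star].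
Qed.

(** The minimal representative [y] lies in the links of both [j] and [k], and a letter of [y] would
    complete a triangle with them. *)
Lemma cent_edge j k (a : G j) (b : G k) x : cycle_adj j k ->
  a <> 1 -> b <> 1 -> commute (cyc_in a * cyc_in b) x ->
  par (pred2 j k) x.
Proof.
move=> jk a1 b1 /commgP /conjg_fixP; set c := _ * _ => e.
have Kc : par (pred2 j k) c.
  by apply: parM; apply: par_in; rewrite /= eqxx ?orbT.
have [p [y [q [ex Ip Jq By]]]] := double_coset (pred2 j k) (pred2 j k) x.
have nkj : k != j by apply: contraTneq jk => ->; rewrite cycle_adj_irr.
have aj : ret j (c ^ p) <> 1.
  rewrite retJ /c retM ret_in ret_in_neq // mulg1 => /eqP.
  by rewrite conjg_eq1 => /eqP.
have bk : ret k (c ^ p) <> 1.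
  rewrite retJ /c retM ret_in ret_in_neq 1?eq_sym // mul1g => /eqP.
  by rewrite conjg_eq1 => /eqP.
have Kcx : par (pred2 j k) (c ^ (p * y * q)) by rewrite -ex e.
have [_ _ jy] := par_conj_double By Ip Jq Kc Kcx (ret_vlen aj).
have [_ _ ky] := par_conj_double By Ip Jq Kc Kcx (ret_vlen bk).
have y1 : y = 1.
  apply: (@par_pred0 n G) => i v0; exfalso.
  exact: (no_triangle n_ge5 jk (ky i v0) (jy i v0)).
by rewrite ex y1 mulg1; apply: parM.
Qed.

Lemma bireduced_star_lead v J y : bireduced (star v) J y -> y <> 1 ->
  exists2 u, (0 < vlen u y)%N & ~~ star v u.
Proof.
move=> [hy _] /lead_ex[u hu]; exists u; first exact: lead_vlen.
by apply/negP => /hy.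
Qed.

(** A nontrivial [y] has a letter at a vertex [u] outside the star of [v]. The vertices that carry
    the intersection lie in the star of [v] and are adjacent to [u], so there is at most one. *)
Lemma star_cap_self v g : ~ par (star v) g -> exists x l, forall z,
  par (star v) z -> par (star v) (z ^ g) -> exists c : G l, z ^ x = cyc_in c.
Proof.
move=> ng; have [p [y [q [eg Ip Jq By]]]] := double_coset (star v) (star v) g.
have y1 : y <> 1 by move=> y1; apply: ng; rewrite eg y1 mulg1; apply: parM.
have [u uy vu] := bireduced_star_lead By y1.
suff [l hl] : exists l, forall i, star v i -> par (cycle_adj i) y -> i = l.
  exists p, l => z Iz; rewrite eg => Jz.
  exists (lead l (z ^ p)); apply: par_pred1 => i.
  case/(par_conj_double By Ip Jq Iz Jz) => vi _ Ly.
  by rewrite /= (hl i vi Ly) eqxx.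
have [[l [vl ly]]|no] := pselect (exists i, star v i /\ par (cycle_adj i) y).
  exists l => i vi iy; apply: (adj_star_uniq n_ge5 vu vi vl); first exact: iy.
  exact: ly.
by exists v => i vi iy; case: no; exists i.
Qed.

Lemma star_cap_edges v w g : (v = w -> ~ par (star v) g) ->
  exists x l, forall z,
    par (star v) z -> par (star w) (z ^ g) -> par (pred2 l (l + 1)%R) (z ^ x).
Proof.
move=> ng; have [p [y [q [eg Ip Jq By]]]] := double_coset (star v) (star w) g.
suff [l hl] : exists l, forall i, star v i -> star w i -> par (cycle_adj i) y ->
    (i == l) || (i == l + 1)%R.
  exists p, l => z Iz; rewrite eg => Jz i.
  by case/(par_conj_double By Ip Jq Iz Jz) => vi wi Ly; apply: hl.
have [y1|y1] := pselect (y = 1).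
  have [|l hl] := @star_cap_edge _ n_ge5 v w; last first.
    by exists l => i vi wi _; apply: hl.
  apply/eqP => e; apply: (ng e); rewrite eg y1 mulg1; subst w.
  exact: parM.
have [u uy vu] := bireduced_star_lead By y1.
have [[l [vl ly]]|no] := pselect (exists i, star v i /\ par (cycle_adj i) y).
  exists l => i vi _ iy; apply/orP; left; apply/eqP.
  by apply: (adj_star_uniq n_ge5 vu vi vl); [apply: iy|apply: ly].
by exists v => i vi _ iy; case: no; exists i.
Qed.

(** The support of a nontrivial common element contains a vertex [l] of both stars that commutes
    with the minimal representative, so a conjugate of the whole [G l] lies in the intersection. *)
Lemma star_cap_vertex v w g z : z <> 1 ->
  par (star v) z -> par (star w) (z ^ g) -> exists x l, forall c : G l,
    par (star v) (cyc_in c ^ x) /\ par (star w) ((cyc_in c ^ x) ^ g).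
Proof.
move=> z1 Iz.
have [p [y [q [-> Ip Jq By]]]] := double_coset (star v) (star w) g.
move=> Jz; have [l hl] := vlen_ex (conjg_neq1 p z1).
have [vl wl ly] := par_conj_double By Ip Jq Iz Jz hl.
exists p^-1, l => c; split.
  by apply: parJ; [apply/parV|apply: par_in].
rewrite -conjgM -mulgA mulKg conjgM.
have /commgP/conjg_fixP-> : commute (cyc_in c) y by apply: link_comm.
by apply: parJ => //; apply: par_in.
Qed.

(* The walls [S_w] and [x S_v] are distinct and not transverse. *)
Definition apart w v x :=
  ~ (star w v /\ exists p q, [/\ par (star w) p, par (star v) q & x = p * q]).

Lemma apartP w v x : apart w v x -> exists p z q,
  [/\ x = p * z * q, par (star w) p, par (star v) q,
      bireduced (star w) (star v) z & (z <> 1 \/ ~~ star w v)].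
Proof.
move=> ax; have [p [z [q [ex Ip Jq Bz]]]] := double_coset (star w) (star v) x.
exists p, z, q; split=> //; have [z1|z1] := pselect (z = 1); last by left.
right; apply/negP => wv; apply: ax; split=> //; exists p, q; split=> //.
by rewrite ex z1 mulg1.
Qed.

Lemma lead_apart w v z t : bireduced (star w) (star v) z ->
  (z <> 1 \/ ~~ star w v) -> (forall i, lead i t <> 1 -> star v i) ->
  lead w (z * t) = 1.
Proof.
move=> Bz hz ht; have [z1|z1] := pselect (z = 1).
  case: hz => // wv; rewrite z1 mul1g; apply: contrapT => /ht.
  by rewrite star_sym (negbTE wv).
have r : rdc z t.
  apply: rdc_leads => i; have [h|h] := pselect (lead i t = 1); [by right|left].
  by case: Bz => _; apply; apply: ht.
apply: lead_rdc1 => //; first by case: Bz => + _; apply; apply: starxx.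
have [u uz wu] := bireduced_star_lead Bz z1.
by move=> /(_ u uz) /adj_star; rewrite (negbTE wu).
Qed.

Lemma par_leads I x i : par I x -> lead i x <> 1 -> I i.
Proof. by move=> Ix /lead_vlen /Ix. Qed.

Lemma lead_wall w v x s : apart w v x -> par (star v) s ->
  lead w (x * s) = lead w x.
Proof.
case/apartP=> p [z [q [-> Ip Jq Bz hz]]] Js.
rewrite -!mulgA !(lead_star _ Ip); congr (_ * _).
rewrite !(lead_apart Bz hz) // => i; apply: par_leads => //.
exact: parM.
Qed.

(* A point that the wall [x S_v] separates from [1] lies in the sector of [S_w]
   that contains [x S_v]. *)
Lemma lead_nested w v x h : apart w v x ->
  lead v (x^-1 * h) <> lead v x^-1 -> lead w h = lead w x.
Proof.
case/apartP=> p [z [q [-> Ip Jq Bz hz]]].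
have Jq' : par (star v) q^-1 by apply/parV.
rewrite !invgM -!mulgA !(lead_star _ Jq') => hne.
have e1 : lead v (z^-1 * p^-1) = 1.
  apply: (lead_apart (bireducedV Bz)) => [|i].
    case: hz => [z1|]; last by rewrite star_sym; right.
    by left=> e; apply: z1; rewrite -[z]invgK e invg1.
  by apply: par_leads; apply/parV.
have ht : lead v (z^-1 * (p^-1 * h)) <> 1.
  by move=> e; apply: hne; rewrite e e1.
have -> : h = p * (z * (z^-1 * (p^-1 * h))) by rewrite !mulVKg.
rewrite !(lead_star _ Ip); congr (_ * _).
rewrite !(lead_apart Bz hz) // => i; first exact: par_leads.
exact: leads_adj.
Qed.

(** An edge can cross the wall S_v only along its own type and from a point of this wall: walls
    apart from S_v stay in one sector, and letters at neighbours of [v] do not affect the lead. *)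
Lemma lead_step v w z (a : G w) : lead v (z * cyc_in a) <> lead v z ->
  w = v /\ par (star v) z.
Proof.
have [az|] := pselect (apart v w z).
  by rewrite (lead_wall az (@par_star_in w a)).
move=> /contrapT[vw [p [q [Ip Jq ez]]]].
have [e|nvw] := eqVneq v w.
  by subst w => _; split=> //; rewrite ez; apply: parM.
rewrite star_adj // in vw; case.
have wv : cycle_adj w v by rewrite cycle_adj_sym.
rewrite ez -mulgA !(lead_star _ Ip); congr (_ * _).
have [m Lm ->] := star_split Jq.
by rewrite -mulgA -(link_comm a Lm) !lead_adj.
Qed.

(* The rotation around the wall [x S_v] that carries the sector of [1] to the
   sector of [y] brings [1] closer to [y]. *)
Lemma fold_lt v x y : lead v (x^-1 * y) <> lead v x^-1 ->
  (len (x * cyc_in (lead v x^-1 * (lead v (x^-1 * y))^-1) * x^-1 * y)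
     < len y)%N.
Proof.
elim/red_ind_r: y => [|w g y g1 hy IHy]; first by rewrite mulg1.
have ly : len (y * cyc_in g) = (len y).+1.
  rewrite -lenV invgM -cyc_inV len_cons ?lenV //.
  by move=> e; apply: g1; rewrite -[g]invgK e invg1.
have [e|ne] := pselect (lead v (x^-1 * (y * cyc_in g)) = lead v (x^-1 * y)).
  rewrite e ly => /IHy; rewrite cycA.
  set X := _ * y; have := lenM X (cyc_in g); have := len_in g; lia.
move: ne; rewrite [x^-1 * (y * _)]mulgA => ne.
have [ew] := lead_step ne; subst w => Sz.
set o := lead v x^-1; set b := lead v (x^-1 * y).
have [m Lm ez] := star_split Sz; rewrite -/b in ez.
have ebg : lead v (x^-1 * y * cyc_in g) = b * g.
  by rewrite lead_star // lead_in.
rewrite ebg => hne.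
have -> : x * cyc_in (o * (b * g)^-1) * x^-1 * (y * cyc_in g) =
    x * cyc_in o * m.
  have -> : x * cyc_in (o * (b * g)^-1) * x^-1 * (y * cyc_in g) =
      x * cyc_in (o * (b * g)^-1) * (x^-1 * y * cyc_in g) by rewrite !mulgA.
  rewrite ez -[_ * m * _]mulgA -(link_comm g Lm) -!mulgA; congr (_ * _).
  rewrite 2!mulgA -[X in X * _]mulgA -!cyc_inM; congr (cyc_in _ * _).
  exact: mulgVK.
(* The rotated images of [y] and [y * cyc_in g] coincide. If [y] has already left the sector of [1],
   the induction hypothesis applies to it; otherwise the rotation undoes the last letter. *)
have [eo|no] := pselect (b = o); last first.
  have := IHy no; rewrite -/o -/b ly.
  have -> : x * cyc_in (o * b^-1) * x^-1 * y = x * cyc_in o * m; last by lia.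
  rewrite -[_ * x^-1 * y]mulgA ez -!mulgA; congr (_ * _).
  by rewrite mulgA -cyc_inM mulgVK.
have -> : x * cyc_in o * m = y by rewrite -eo -mulgA -ez mulVKg.
by rewrite ly.
Qed.

End Stars.
Arguments conjg_neq1 {n G z} x _ _.

(** * Walls and axes *)

Section Walls.
Variables (n : nat) (G : 'Z_n -> groupType).
Hypothesis n_ge5 : (5 <= n)%N.
Local Notation C := (cyclic_prod G).
Implicit Types (i j k l u v w : 'Z_n) (x y z p q g h s t : C).
Implicit Types (I J : pred 'Z_n) (m r : nat).

(** The equation on lengths makes this a reduced factorization in which [a] is the [G v] syllable of
    index [m], counting from 0. *)
Definition wall_at v g m p := exists (a : G v) q,
  [/\ g = p * (cyc_in a * q), a <> 1, len g = (len p + (len q).+1)%N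
    & vlen v p = m].

Lemma len_letter i (a : G i) : a <> 1 -> len (cyc_in a) = 1%N.
Proof. by move=> a1; rewrite -[cyc_in a]mulg1 len_cons ?lead1 // len1. Qed.

Lemma lead_letterV i (a : G i) x : lead i x^-1 = 1 -> rdc x (cyc_in a).
Proof.
by move=> hx; rewrite -[x]invgK -[cyc_in a]invgK -cyc_inV; apply/rdcV/rdc_cons.
Qed.

Lemma strip_exV i x :
  exists2 y, x = y * cyc_in (lead i x^-1)^-1 & lead i y^-1 = 1.
Proof.
have [y ex hy] := strip_ex i x^-1; exists y^-1; rewrite ?invgK //.
by rewrite cyc_inV -invgM -ex invgK.
Qed.

Lemma wall_atP v g m p : wall_at v g m p -> exists (a : G v) q,
  [/\ g = p * (cyc_in a * q), a <> 1, rdc p (cyc_in a * q), rdc (cyc_in a) q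
    & vlen v p = m].
Proof.
case=> a [q [eg a1 lg vp]]; have la := len_letter a1.
have := lenM p (cyc_in a * q); have := lenM (cyc_in a) q.
rewrite -eg lg la => le1 le2; exists a, q.
by split=> //; rewrite /rdc -?eg ?lg ?la; lia.
Qed.

Lemma wall_at_vlen v g m p : wall_at v g m p -> exists (a : G v) q,
  [/\ g = p * (cyc_in a * q), a <> 1, vlen v g = (m + (vlen v q).+1)%N
    & len g = (len p + (len q).+1)%N].
Proof.
move=> w; have [a [q [eg a1 r1 r2 vp]]] := wall_atP w; exists a, q; split=> //.
  by rewrite eg !rdc_vlen // vp vlen_in eqxx (introF eqP a1).
by rewrite eg r1 r2 len_letter.
Qed.

Lemma wall_extr v g m p y : rdc g y -> wall_at v g m p -> wall_at v (g * y) m p.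
Proof.
move=> r [a [q [eg a1 lg vp]]]; exists a, (q * y).
have e : g * y = p * (cyc_in a * (q * y)) by rewrite eg !cycA.
split=> //; have := lenM p (cyc_in a * (q * y)).
have := lenM (cyc_in a) (q * y); have := lenM q y.
by rewrite -e r lg len_letter //; lia.
Qed.

Lemma wall_extl v g m p y : rdc y g -> wall_at v g m p ->
  wall_at v (y * g) (vlen v y + m) (y * p).
Proof.
move=> r [a [q [eg a1 lg vp]]]; exists a, q.
have e : y * g = y * p * (cyc_in a * q) by rewrite eg !cycA.
have lyp : len (y * p) = (len y + len p)%N.
  have := lenM (y * p) (cyc_in a * q); have := lenM (cyc_in a) q.
  by have := lenM y p; rewrite -e r lg len_letter //; lia.
by split=> //; [rewrite r lg lyp addnA|rewrite rdc_vlen // vp].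
Qed.

Lemma wall_at_ex v g m : (m < vlen v g)%N -> exists p, wall_at v g m p.
Proof.
elim/red_ind: g m => [m|i b g b1 hg IHg m]; first by rewrite vlen1.
rewrite vlen_cons //; have vb : vlen v (cyc_in b) = (i == v) :> nat.
  by rewrite vlen_in (introF eqP b1) andbT.
have [e|iv] := eqVneq i v.
  subst i; case: m => [_|m].
    exists 1, b, g; rewrite mul1g len_cons // len1 add0n vlen1; split=> //.
  rewrite add1n ltnS => /IHg[p /(wall_extl (rdc_cons b hg)) w].
  by exists (cyc_in b * p); move: w; rewrite vb eqxx.
move=> /IHg[p /(wall_extl (rdc_cons b hg)) w].
by exists (cyc_in b * p); move: w; rewrite vb (negbTE iv).
Qed.

Lemma wall_at_strip v w g m p (b : G w) : b <> 1 -> lead w g = b ->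
  lead w p = b ->
  wall_at v g m p -> exists p', p = cyc_in b * p' /\
    wall_at v (cyc_in b^-1 * g) (m - (w == v)) p'.
Proof.
move=> b1 hg hp [a [q [eg a1 lg vp]]].
have [p' ep' hp'] := strip_ex w p; rewrite hp in ep'; exists p'; split=> //.
exists a, q; split=> //; first by rewrite eg ep' cyc_inV -!mulgA mulKg.
  have [g' eg' hg'] := strip_ex w g; rewrite hg in eg'.
  rewrite {1}eg' cyc_inV mulKg.
  move: lg; rewrite eg' ep' !len_cons // => -[]; lia.
by move: vp; rewrite ep' vlen_cons //; lia.
Qed.

(** Reduced words of [g] differ by exchanges of commuting letters; the induction strips the first
    letter [t] of [p] from both factorizations. *)
Lemma wall_at_uniq v g m p p' : wall_at v g m p -> wall_at v g m p' ->
  par (star v) (p^-1 * p').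
Proof.
elim/red_ind: p m g p' => [|w t p t1 hp IHp] m g p' W W'.
  have [a [q [eg a1 _ r vp]]] := wall_atP W.
  have [a' [q' [eg' a1' r1' r2' vp']]] := wall_atP W'.
  rewrite invg1 mul1g; apply: link_star; apply: contrapT => np.
  have : lead v g = 1.
    rewrite eg' lead_rdc1 //; apply: contrapT => /lead_vlen.
    by rewrite vp' -vp vlen1.
  by rewrite eg mul1g lead_rdc ?lead_in.
have hpt : lead w (cyc_in t * p) = t by rewrite leadM hp mulg1.
have hg : lead w g = t.
  have [a [q [eg _ r _ _]]] := wall_atP W.
  by rewrite eg (lead_rdc r) ?hpt.
have [p1 [/mulgI<- W1]] := wall_at_strip t1 hg hpt W.
have [hp'1|hp'] := pselect (lead w p' = 1); last first.
  have ep' : lead w p' = t.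
    have [a' [q' [eg' _ r _ _]]] := wall_atP W'.
    by rewrite -hg eg' lead_rdc.
  have [p1' [-> W1']] := wall_at_strip t1 hg ep' W'.
  by rewrite invgM -mulgA mulKg; apply: IHp W1 W1'.
(* Here [t] starts [g] but not [p'], so it comes from [q'] and commutes with [p'] and [a']; removing
   it leaves the prefix [p'] unchanged. *)
have [a' [q' [eg' a1' r1' r2' vp']]] := wall_atP W'.
have Lp' : par (cycle_adj w) p'.
  by apply: contrapT => np; apply: t1; rewrite -hg eg' lead_rdc1.
have wv : w != v.
  apply/eqP => e; subst w.
  have [a [q [_ _ _ _ vp]]] := wall_atP W.
  have := par_vlen Lp' (negbT (cycle_adj_irr v)).
  by rewrite vp' -vp vlen_cons // eqxx.
have haq : lead w (cyc_in a' * q') = t by rewrite -hg eg' (lead_link _ Lp').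
have havq : lead v (cyc_in a' * q') = a'.
  by rewrite lead_rdc ?lead_in //.
have vw : cycle_adj v w.
  rewrite -star_adj 1?eq_sym //; apply: (@leads_adj _ _ _ _ (cyc_in a' * q')).
    by rewrite havq.
  by rewrite haq.
have hq' : lead w q' = t by rewrite -haq lead_adj.
have [q1 eq1 hq1] := strip_ex w q'; rewrite hq' in eq1.
have W2 : wall_at v (cyc_in t^-1 * g) m p'.
  have eg1 : cyc_in t^-1 * g = p' * (cyc_in a' * q1).
    rewrite cyc_inV; apply: (mulgI (cyc_in t)); rewrite mulVKg eg' eq1.
    rewrite !mulgA (link_comm t Lp') -(mulgA p') (cyc_inC a' t) ?mulgA //.
  exists a', q1; split=> //; have := rdc_cons t hq1.
  have [g1 eg2 hg1] := strip_ex w g; rewrite hg in eg2.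
  have lg : len g = (len (cyc_in t^-1 * g)).+1.
    by rewrite {1}eg2 len_cons // eg2 cyc_inV mulKg.
  have : len g = (len p' + (len q').+1)%N by rewrite eg' r1' r2' len_letter.
  rewrite eq1 lg /rdc len_letter //; lia.
rewrite (negbTE wv) subn0 in W1.
have := IHp _ _ _ W1 W2; rewrite invgM -mulgA => h.
have -> : (cyc_in t)^-1 * p' = p' * (cyc_in t)^-1.
  by rewrite -cyc_inV; apply: link_comm.
rewrite mulgA; apply: parM => //; apply/parV/par_in; exact: adj_star.
Qed.

(* Geodesics from [1] to [g] cross [x S_v] as their [m]-th wall of type [v],
   counting from 0. *)
Definition wall v g m x := exists2 p, wall_at v g m p & par (star v) (p^-1 * x).

Lemma wall_uniq v g m x y : wall v g m x -> wall v g m y ->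
  par (star v) (x^-1 * y).
Proof.
move=> [p Wp Sx] [q Wq Sy].
have -> : x^-1 * y = (p^-1 * x)^-1 * ((p^-1 * q) * (q^-1 * y)).
  by rewrite invgM invgK -!mulgA mulVKg !mulVKg.
apply: parM; first exact/parV.
by apply: parM => //; apply: wall_at_uniq Wp Wq.
Qed.

Lemma wall_of_at v g m p : wall_at v g m p -> wall v g m p.
Proof. by exists p; rewrite // mulVg; apply: par1. Qed.

Lemma wall_ex v g m : (m < vlen v g)%N -> exists x, wall v g m x.
Proof. by case/wall_at_ex => p /wall_of_at; exists p. Qed.

Lemma wall_move v g m x y : wall v g m x -> wall v g m y ->
  forall h, wall v h m y -> wall v h m x.
Proof.
move=> Wx Wy h [p Wp Sy]; exists p => //.
have -> : p^-1 * x = (p^-1 * y) * (y^-1 * x) by rewrite -mulgA mulVKg.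
by apply: parM => //; apply: wall_uniq Wy Wx.
Qed.

(** Multiplying by a letter alters at most one final syllable of [g], so a wall is kept as long as
    its index still occurs. *)
Lemma wall_letter v g m x w (b : G w) : wall v g m x ->
  (m < vlen v (g * cyc_in b))%N -> wall v (g * cyc_in b) m x.
Proof.
move=> Wx; have mg : (m < vlen v g)%N.
  case: Wx => p /wall_at_vlen[a [q [_ _ -> _]]] _; lia.
have [g' eg hg'] := strip_exV w g; set c := (lead w g^-1)^-1 in eg.
have egb : g * cyc_in b = g' * cyc_in (c * b) by rewrite cyc_inM mulgA -eg.
have r d : rdc g' (cyc_in (d : G w)) by apply: lead_letterV.
rewrite egb => mgb; have [lt|ge] := ltnP m (vlen v g').
  have [p Wp] := wall_at_ex lt; apply: (@wall_move v g m x p) => //.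
    by rewrite eg; apply/wall_of_at/wall_extr.
  exact/wall_of_at/wall_extr.
move: mg mgb; rewrite {1}eg !rdc_vlen // !vlen_in.
have [e|//] := eqVneq w v; [subst w|by lia].
have [->|/eqP c1] := eqVneq c 1; first by lia.
have [->|/eqP cb1] := eqVneq (c * b) 1; first by lia.
move=> lt _; have em : vlen v g' = m by lia.
have W d : d <> 1 -> wall v (g' * cyc_in (d : G v)) m g'.
  move=> d1; apply: wall_of_at; exists d, 1; rewrite mulg1 (r d) len_letter //.
  by rewrite len1.
by apply: (@wall_move v g m x g') => //; [rewrite eg; apply: W|apply: W].
Qed.

Lemma wallMr v g m x y : wall v g m x -> (m + vlen v y < vlen v g)%N ->
  wall v (g * y) m x.
Proof.
elim/red_ind: y g => [|w b y b1 hy IHy] g Wx; first by rewrite mulg1.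
rewrite vlen_cons // cycA => lt; have := vlenM v (g * cyc_in b) (cyc_in b)^-1.
rewrite mulgK vlenV vlen_in (introF eqP b1) andbT => le.
apply: IHy; last by lia.
by apply: wall_letter => //; lia.
Qed.

Lemma wallV v g m r x : wall v g m x -> (m + r.+1 = vlen v g)%N ->
  wall v g^-1 r (g^-1 * x).
Proof.
move=> [p W Sx] emr; have [a [q [eg a1 vg lg]]] := wall_at_vlen W.
have a1V : a^-1 <> 1 by move=> e; apply: a1; rewrite -[a]invgK e invg1.
exists q^-1.
  exists a^-1, p^-1; split=> //.
  - by rewrite eg !invgM cyc_inV mulgA.
  - by rewrite !lenV lg -addSnnS addnC.
  - by rewrite vlenV; lia.
have -> : q^-1^-1 * (g^-1 * x) = (cyc_in a)^-1 * (p^-1 * x).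
  by rewrite eg !invgM !invgK -!mulgA mulVKg.
by apply: parM => //; apply/parV/par_in/starxx.
Qed.

Lemma wallMl v g m r x y : wall v g m x -> (vlen v y <= m)%N ->
  (m + vlen v (y * g) = r + vlen v g)%N -> wall v (y * g) r (y * x).
Proof.
move=> Wx le e; have mg : (m < vlen v g)%N.
  case: Wx => p /wall_at_vlen[a [q [_ _ -> _]]] _; lia.
have [m' em] : exists m', (m + m'.+1 = vlen v g)%N.
  by exists (vlen v g - m.+1)%N; lia.
have lt : (m' + vlen v y^-1 < vlen v g^-1)%N by rewrite !vlenV; lia.
have W := wallMr (wallV Wx em) lt; rewrite -invgM in W.
have em' : (m' + r.+1 = vlen v (y * g)^-1)%N by rewrite vlenV; lia.
by have := wallV W em'; rewrite invgK -mulgA mulVKg.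
Qed.

(** As [y] commutes with [g], translation by [y] sends walls crossed by [g], away from both ends, to
    walls crossed by [g]. The index shift [vlen v (g * y) - vlen v g] does not depend on the wall;
    it may be negative, hence the equation. *)
Lemma wall_commute v g m x y : commute g y -> wall v g m x ->
  (vlen v y <= m)%N -> (m + vlen v y < vlen v g)%N ->
  exists r, wall v g r (y * x) /\ (m + vlen v (g * y) = r + vlen v g)%N.
Proof.
move=> cgy Wx le lt; have e : g * y = y * g := cgy.
have le1 := vlenM v (g * y) y^-1; rewrite mulgK vlenV in le1.
have le2 := vlenM v g y.
have [r er] : exists r, (m + vlen v (g * y)%g = r + vlen v g)%N.
  by exists (m + vlen v (g * y)%g - vlen v g)%N; lia.
exists r; split=> //.
have W : wall v (y * g) r (y * x).
  by apply: (wallMl Wx) => //; rewrite -e; lia.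
have := wallMr (y := y^-1) W; rewrite -e mulgK vlenV; apply; lia.
Qed.

(** The index shifts of [y] and [z] add up, so [y * z] and [z * y] send the wall to the same
    wall. *)
Lemma wall_comm v g m x y z : commute g y -> commute g z -> wall v g m x ->
  (vlen v y + vlen v z <= m)%N -> (m + vlen v y + vlen v z < vlen v g)%N ->
  par (star v) ([~ y, z] ^ x).
Proof.
move=> cy cz Wx le lt.
have ly := vlenM v g y; have lz := vlenM v g z.
have ly' := vlenM v (g * y) y^-1; have lz' := vlenM v (g * z) z^-1.
rewrite mulgK vlenV in ly'; rewrite mulgK vlenV in lz'.
have [||ry [Wy ey]] := wall_commute cy Wx; try lia.
have [||rz [Wz ez]] := wall_commute cz Wx; try lia.
have [||r [W e]] := wall_commute cz Wy; try lia.
have [||r' [W' e']] := wall_commute cy Wz; try lia.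
have err : r = r' by lia.
subst r'; have := wall_uniq W W'.
by rewrite /commg /conjg !invgM !mulgA.
Qed.

(** No prefix of a wall ends with a [G v] syllable. If the walls agreed, the prefixes would thus
    differ by an element of the link of [v] and contain equally many [G v] syllables. *)
Lemma wall_succ v g m x y : wall v g m x -> wall v g m.+1 y ->
  ~ par (star v) (x^-1 * y).
Proof.
move=> [p Wp Sp] [q Wq Sq] Sxy.
have {Sxy Sp Sq x y} Spq : par (star v) (p^-1 * q).
  have -> : p^-1 * q = (p^-1 * x) * (x^-1 * y) * (q^-1 * y)^-1.
    by rewrite invgM invgK -!mulgA !mulVKg.
  by do !apply: parM => //; apply/parV.
have lead0 (k : nat) s : wall_at v g k s -> lead v s^-1 = 1.
  case/wall_atP => a [t [eg a1 r1 r2 _]]; apply: contrapT => h.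
  have [s' es hs'] := strip_exV v s.
  have ls : len s = (len s').+1.
    rewrite es lead_letterV // len_letter ?addn1 // => e.
    by apply: h; rewrite -[LHS]invgK e invg1.
  have e : s * (cyc_in a * t) = s' * (cyc_in ((lead v s^-1)^-1 * a) * t).
    by rewrite cyc_inM !cycA -es.
  have := lenM s' (cyc_in ((lead v s^-1)^-1 * a) * t); rewrite -e r1 r2 ls.
  have := lenM (cyc_in ((lead v s^-1)^-1 * a)) t.
  have := len_in ((lead v s^-1)^-1 * a); rewrite (len_letter a1); lia.
have [l Ll es] := star_split Spq.
have eq : q = p * (p^-1 * q) by rewrite mulVKg.
have := lead0 _ _ Wq; rewrite eq invgM lead_star; last exact/parV.
rewrite (lead0 _ _ Wp) mulg1 lead_starV // => /eqP; rewrite invg_eq1 => /eqP e1.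
rewrite e1 cyc_in1 mul1g in es.
have := vlenM v p l; rewrite (par_vlen Ll (negbT (cycle_adj_irr v))) -es mulVKg.
have [_ [_ [_ _ _ _ ->]]] := wall_atP Wp.
have [_ [_ [_ _ _ _ ->]]] := wall_atP Wq.
lia.
Qed.

(** Commutators of elements that commute with [h] preserve two consecutive walls crossed by a large
    power of [h], and [star_cap_self] confines them to a conjugate of one vertex group. *)
Lemma axis_comm v h : (forall m, (m <= vlen v (h ^+ m))%N) ->
  forall y z b, commute h y -> commute h z -> commute h b ->
  exists x l (c d : G l),
    [~ y, z] ^ x = cyc_in c /\ ([~ y, z] ^ b) ^ x = cyc_in d.
Proof.
move=> hv y z b cy cz cb.
have cb' t : commute h t -> commute h (t ^ b).
  by move=> ct; rewrite /conjg; do !apply: commuteM => //; apply: commuteV.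
(* [N] bounds the index shifts by all four elements, and the exponent [2N + 3] keeps the walls of
   index [N] and [N + 1] far enough from both ends. *)
pose N := (vlen v y + vlen v z + vlen v (y ^ b) + vlen v (z ^ b))%N.
pose g := h ^+ (N + N + 3)%N.
have cg t : commute h t -> commute g t.
  by move=> ct; apply/commute_sym/commuteX/commute_sym.
have lg : (N + N + 3 <= vlen v g)%N by apply: hv.
have [|x Wx] := @wall_ex v g N; first by lia.
have [|x' Wx'] := @wall_ex v g N.+1; first by lia.
have nS := wall_succ Wx Wx'.
have [x0 [l hl]] := star_cap_self n_ge5 nS.
have S t s m (w : C) : commute h t -> commute h s ->
    (vlen v t + vlen v s <= N)%N -> (N <= m <= N.+1)%N -> wall v g m w ->
    par (star v) ([~ t, s] ^ w).
  move=> ct cs lN mN Ww; apply: wall_comm Ww _ _; try exact: cg; lia.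
have K t s : commute h t -> commute h s -> (vlen v t + vlen v s <= N)%N ->
    exists c : G l, [~ t, s] ^ (x * x0) = cyc_in c.
  move=> ct cs lN; rewrite conjgM; apply: hl.
    by apply: (@S t s N) => //; lia.
  by rewrite -conjgM mulVKg; apply: (@S t s N.+1) => //; lia.
have [|c ec] := K y z cy cz; first by rewrite /N; lia.
have [|d ed] := K (y ^ b) (z ^ b) (cb' _ cy) (cb' _ cz).
  by rewrite /N; lia.
by exists (x * x0), l, c, d; split=> //; rewrite -ed conjRg.
Qed.

(** Move the letters of the link of [v] from the end of [x] to [y]. What remains of [x] ends at no
    vertex of the star of [v], whereas the other factor starts only inside this star, so nothing
    cancels between them. *)
Lemma vlen_axis v x y : lead v x^-1 = 1 -> lead v x <> 1 -> lead v y <> 1 ->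
  vlen v (x * y) = (vlen v x + vlen v y)%N /\ lead v (x * y) = lead v x.
Proof.
move=> hxV hx hy.
have [l [x1 [ex Ll hx1 r]]] := coset_min (cycle_adj v) x^-1.
have {}ex : x = x1^-1 * l^-1 by rewrite -invgM -ex invgK.
have hx1v : lead v x1 = 1 by rewrite -(lead_link x1 Ll) -hxV ex invgM !invgK.
have LlV : par (cycle_adj v) l^-1 by apply/parV.
have hly : lead v (l^-1 * y) = lead v y by rewrite lead_link.
have r0 : rdc x1^-1 (l^-1 * y).
  apply: rdc_leads => i; rewrite invgK.
  have [->|iv] := eqVneq i v; first by left.
  have [vi|nvi] := boolP (cycle_adj v i); first by left; apply: hx1.
  right; apply: contrapT => hi.
  have /leads_adj/(_ hi) : lead v (l^-1 * y) <> 1 by rewrite hly.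
  by rewrite eq_sym (negbTE iv) (negbTE nvi).
have r1 := rdcV r.
have hx0 : lead v x1^-1 <> 1.
  move=> e; apply: hx; rewrite ex.
  have [p|np] := pselect (par (cycle_adj v) x1^-1).
    by rewrite lead_link // -[l^-1]mulg1 lead_link // lead1.
  by rewrite lead_rdc1.
split; last by rewrite ex -mulgA !lead_rdc.
have vl : vlen v l^-1 = 0%N by apply: par_vlen LlV (negbT (cycle_adj_irr v)).
rewrite ex -mulgA (rdc_vlen _ r0) (rdc_vlen _ r1) vl addn0.
congr addn; apply/eqP.
have := vlenM v l^-1 y; have := vlenM v l (l^-1 * y).
by rewrite mulVKg -[vlen v l]vlenV vl !add0n eqn_leq => -> ->.
Qed.

Lemma vlen_axis_exp v h : lead v h^-1 = 1 -> lead v h <> 1 ->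
  forall m, (m <= vlen v (h ^+ m))%N.
Proof.
move=> hV h1 m; suff : (m <= vlen v (h ^+ m))%N /\
    (m = 0%N \/ lead v (h ^+ m) <> 1) by case.
elim: m => [|m [IH1 IH2]]; first by split; [|left].
rewrite expgS; case: IH2 => [->|h2].
  by rewrite expg0 mulg1; split; [apply: lead_vlen|right].
have [-> ->] := vlen_axis hV h1 h2; split; last by right.
by have := lead_vlen h1; lia.
Qed.

(* The conjugates that occur here have minimal length in the class of [h]. *)
Lemma edge_or_axis h :
  (exists x l, par (pred2 l (l + 1)%R) (h ^ x)) \/
  (exists x v, forall m, (m <= vlen v ((h ^ x) ^+ m))%N).
Proof.
have [k [x0 ek] kmin] : exists2 k, exists x, k = h ^ x &
    forall y, (len k <= len (k ^ y))%N.
  have ex : exists m, `[< exists x, len (h ^ x) = m >].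
    by exists (len (h ^ 1)); apply/asboolP; exists 1.
  case: (ex_minnP ex) => m /asboolP[x lx] hmin.
  exists (h ^ x); first by exists x.
  by move=> y; rewrite lx -conjgM; apply: hmin; apply/asboolP; exists (x * y).
have [cl|] := pselect (forall i j,
    (0 < vlen i k)%N -> (0 < vlen j k)%N -> star i j).
  left; have [l hl] := clique_edge n_ge5 cl.
  by exists x0, l; rewrite -ek => i /hl.
move=> /existsNP[v /existsNP[w /not_implyP[vk /not_implyP[wk /negP vw]]]].
right.
(* Rotate [k] cyclically so that it starts with a [G v] syllable [a]; minimality keeps the rotated
   product reduced. *)
have [p W] := wall_at_ex vk; have [a [q [eg a1 r1 r2 vp]]] := wall_atP W.
have ek' : k ^ p = cyc_in a * (q * p) by rewrite /conjg eg !mulgA mulVg mul1g.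
have lr := lenM q p; have la := len_letter a1.
have lk2 : len k = (len p + (len q).+1)%N by rewrite eg r1 r2 la.
have rr : rdc q p /\ rdc (cyc_in a) (q * p).
  have := kmin p; have := lenM (cyc_in a) (q * p); rewrite ek' la /rdc la.
  by move=> le1 le2; split; lia.
case: rr => rqp ra.
have nwv : w != v by apply: contraNneq vw => ->; apply: starxx.
have wr : (0 < vlen w (q * p))%N.
  move: wk; rewrite eg !rdc_vlen // vlen_in eq_sym (negbTE nwv) /= add0n.
  by rewrite addnC.
have ha : lead v (k ^ p) = a by rewrite ek' lead_rdc ?lead_in //.
exists (x0 * p), v; rewrite conjgM -ek.
apply: vlen_axis_exp; last by rewrite ha.
rewrite ek' invgM -cyc_inV; set r := q * p in ek' ra wr *.
have [hr|hr] := pselect (lead v r^-1 = 1).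
  apply: lead_rdc1 => //; first by rewrite cyc_inV; apply: rdcV.
  move=> /(_ w); rewrite vlenV => /(_ wr) /adj_star; exact/negP.
(* If [r] ended in [G v], this syllable would merge with [a] in a conjugate shorter than [k]. *)
have [r0 er hr0] := strip_exV v r.
have lr0 : len r = (len r0).+1.
  rewrite er lead_letterV // len_letter ?addn1 // => e.
  by apply: hr; rewrite -[LHS]invgK e invg1.
pose d : G v := (lead v r^-1)^-1 * a.
have le : (len k <= len (r0 * cyc_in d)%g)%N.
  have -> : r0 * cyc_in d = k ^ (p * cyc_in a); last exact: kmin.
  by rewrite conjgM ek' /conjg mulgA mulKg {1}er -mulgA -cyc_inM.
have lrr : len r = (len q + len p)%N := rqp.
by exfalso; have := lenM r0 (cyc_in d); have := len_in d; lia.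
Qed.

End Walls.

(** * Images of stars and of vertex groups *)

Section Products.
Variables (n : nat) (G : 'Z_n -> groupType).
Hypothesis n_ge5 : (5 <= n)%N.
Local Notation C := (cyclic_prod G).
Implicit Types (i j k l u v w : 'Z_n) (x y z p q g h s t : C).
Implicit Types (I J : pred 'Z_n) (A B : C -> Prop).

Lemma commuteJ x y z : commute x y -> commute (x ^ z) (y ^ z).
Proof. by move=> e; rewrite /commute -!conjMg e. Qed.

Lemma commuteR x y z : commute x y -> commute x z -> commute x [~ y, z].
Proof.
move=> cy cz; rewrite /commg /conjg.
by do !apply: commuteM => //; apply: commuteV.
Qed.

Lemma par_pred2 l k z : cycle_adj l k -> par (pred2 l k) z ->
  exists (a : G l) (b : G k), z = cyc_in a * cyc_in b.
Proof.
move=> lk Pz; have Sz : par (star l) z.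
  by apply: par_sub Pz => i /orP[]/eqP->; [apply: starxx|apply: adj_star].
have [m Lm ez] := star_split Sz; exists (lead l z), (lead k m).
rewrite {1}ez; congr (_ * _); apply: par_pred1 => i hi; have li := Lm i hi.
have Pm : par (pred2 l k) m.
  apply: (@parMl _ _ _ (cyc_in (lead l z))); rewrite -?ez //.
  by apply: par_in; rewrite /= eqxx.
by case/orP: (Pm i hi) => // /eqP e; rewrite e cycle_adj_irr in li.
Qed.

Lemma pred2_starl l z : par (pred2 l (l + 1)%R) z -> par (star l) z.
Proof.
by apply: par_sub => i /orP[]/eqP->; [apply: starxx|apply/adj_star/adj_succ].
Qed.

Lemma pred2_starr l z : par (pred2 l (l + 1)%R) z -> par (star (l + 1)%R) z.
Proof.
apply: par_sub => i /orP[]/eqP->; last exact: starxx.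
by rewrite star_sym; apply/adj_star/adj_succ.
Qed.

Lemma star_product_edge A B x l : (forall a b, A a -> B b -> commute a b) ->
  (exists2 b, B b & b <> 1) ->
  (forall b, B b -> par (pred2 l (l + 1)%R) (b ^ x)) ->
  exists y k, forall z, A z \/ B z -> par (star k) (z ^ y).
Proof.
move=> cAB [b Bb b1] PB; exists x.
have [c [d eb]] := par_pred2 (adj_succ l) (PB b Bb).
have cA a : A a -> commute (b ^ x) (a ^ x).
  by move=> Aa; apply/commuteJ/commute_sym/cAB.
have [c1|c1] := pselect (c = 1).
  exists (l + 1)%R => z [Az|/PB/pred2_starr //].
  have d1 : d <> 1.
    by move=> d1; apply: (conjg_neq1 x b1); rewrite eb c1 d1 !cyc_in1 mulg1.
  apply: (cent_vertex d1); have := cA z Az.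
  by rewrite eb c1 cyc_in1 mul1g.
exists l => z [Az|/PB/pred2_starl //].
have [d1|d1] := pselect (d = 1).
  by apply: (cent_vertex c1); have := cA z Az; rewrite eb d1 cyc_in1 mulg1.
apply: pred2_starl; apply: (cent_edge n_ge5 (adj_succ l) c1 d1).
by rewrite -eb; apply: cA.
Qed.

(** Three cases: [A] contains an element with an axis, or one with two nontrivial components in an
    edge group, or only conjugates of vertex elements. *)
Lemma star_product A B : (forall a b, A a -> B b -> commute a b) ->
  (exists2 a, A a & a <> 1) ->
  (exists b c, [/\ B b, B c & ~ commute b c]) ->
  exists x k, forall z, A z \/ B z -> par (star k) (z ^ x).
Proof.
move=> cAB [a Aa a1] [b1 [b2 [Bb1 Bb2 nb]]]; set u := [~ b1, b2].
have u1 : u <> 1 by move=> e; apply: nb; apply/commgP/eqP.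
have exB : exists2 b, B b & b <> 1.
  by exists b1 => // e; apply: nb; rewrite e; apply/commute_sym/commute1.
have cAu z : A z -> commute u z.
  by move=> Az; apply/commute_sym/commuteR; apply: cAB.
(* With an axis, [u] and [u ^ b] lie in a common conjugate of a vertex group for each [b] in [B], so
   [conj_vertex] puts [b] in the conjugate of its star. The elements of [A] centralize [u], so they
   lie there too. *)
have [[a' [Aa' [x0 [v hv]]]]|noaxis] := pselect (exists a', A a' /\
    exists x v, forall m, (m <= vlen v ((a' ^ x) ^+ m))%N).
  have comm b : B b -> exists x l (c d : G l),
      u ^ x = cyc_in c /\ (u ^ b) ^ x = cyc_in d.
    move=> Bb; have cJ t : B t -> commute (a' ^ x0) (t ^ x0).
      by move=> Bt; apply/commuteJ/cAB.
    have [x [l [c [d [ec ed]]]]] :=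
      axis_comm n_ge5 hv (cJ _ Bb1) (cJ _ Bb2) (cJ _ Bb).
    rewrite -conjRg in ec ed; exists (x0 * x), l, c, d.
    by rewrite !conjgM (conjJg u b x0) -ec -ed.
  have [x [l [c [_ [ec _]]]]] := comm b1 Bb1.
  have c1 : c <> 1.
    by move=> c1; apply: (conjg_neq1 x u1); rewrite ec c1 cyc_in1.
  exists x, l => z [Az|Bz].
    by apply: (cent_vertex c1); rewrite -ec; apply/commuteJ/cAu.
  have [y [k [d [e [ed ee]]]]] := comm z Bz.
  have : cyc_in c ^ (x^-1 * y) = cyc_in d by rewrite -ec -conjgM mulVKg.
  move=> /(conj_vertex c1)[? Sxy]; subst k.
  have d1 : d <> 1.
    by move=> d1; apply: (conjg_neq1 y u1); rewrite ed d1 cyc_in1.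
  have Szy : par (star l) (z ^ y).
    have : cyc_in d ^ (z ^ y) = cyc_in e by rewrite -ed -ee -conjJg.
    by case/(conj_vertex d1).
  have -> : z ^ x = (z ^ y) ^ (x^-1 * y)^-1.
    by rewrite -conjgM invgM invgK mulVKg.
  by apply: parJ => //; apply/parV.
have ell a' : A a' -> exists x l, par (pred2 l (l + 1)%R) (a' ^ x).
  move=> Aa'; have [//|ax] := edge_or_axis n_ge5 a'.
  by case: noaxis; exists a'.
have [[a' [Aa' [x [l [c [d [c1 d1 ea]]]]]]]|noedge] := pselect (exists a',
    A a' /\ exists x l (c : G l) (d : G (l + 1)%R),
    [/\ c <> 1, d <> 1 & a' ^ x = cyc_in c * cyc_in d]).
  apply: (star_product_edge (x := x) (l := l) cAB) => // b Bb.
  apply: (cent_edge n_ge5 (adj_succ l) c1 d1).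
  by rewrite -ea; apply/commuteJ/cAB.
have vert a' : A a' -> a' <> 1 ->
    exists x j (c : G j), c <> 1 /\ a' ^ x = cyc_in c.
  move=> Aa' a1'; have [x [l Px]] := ell a' Aa'.
  have [c [d ea]] := par_pred2 (adj_succ l) Px; exists x.
  have [c1|c1] := pselect (c = 1).
    exists (l + 1)%R, d; split; last by rewrite ea c1 cyc_in1 mul1g.
    by move=> d1; apply: (conjg_neq1 x a1'); rewrite ea c1 d1 !cyc_in1 mulg1.
  exists l, c; split=> //.
  have [d1|d1] := pselect (d = 1); first by rewrite ea d1 cyc_in1 mulg1.
  by case: noedge; exists a'; split=> //; exists x, l, c, d.
have [x [j [c [c1 ea]]]] := vert a Aa a1.
have SB b : B b -> par (star j) (b ^ x).
  by move=> Bb; apply: (cent_vertex c1); rewrite -ea; apply/commuteJ/cAB.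
(* Every nontrivial element of [A] gives a wall whose stabilizer contains [B]. Two different walls
   confine [B] to an edge group; otherwise all elements of [A] share one wall. *)
have [[y [k [ng PB]]]|no] := pselect (exists y k,
    (j = k -> ~ par (star j) (x^-1 * y)) /\
    forall b, B b -> par (star k) (b ^ y)).
  have [x0 [l hl]] := star_cap_edges n_ge5 ng.
  apply: (star_product_edge (x := x * x0) (l := l) cAB) => // b Bb.
  by rewrite conjgM; apply: hl; [apply: SB|rewrite -conjgM mulVKg; apply: PB].
exists x, j => z [Az|/SB //].
have [->|z1] := pselect (z = 1); first by rewrite conj1g; apply: par1.
have [y [k [d [d1 ez]]]] := vert z Az z1.
have [[ejk S]|nj] := pselect (j = k /\ par (star j) (x^-1 * y)); last first.
  case: no; exists y, k; split=> [ejk S|b Bb]; first by apply: nj.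
  by apply: (cent_vertex d1); rewrite -ez; apply/commuteJ/cAB.
subst k; have -> : z ^ x = cyc_in d ^ (x^-1 * y)^-1.
  by rewrite -ez -conjgM invgM invgK mulVKg.
by apply: parJ; [apply/parV|apply: par_star_in].
Qed.

Lemma pred1_normal i g z : par (star i) g -> par (pred1 i) z ->
  par (pred1 i) (z ^ g).
Proof.
move=> /star_split[m Lm ->] Pz; rewrite conjgM.
have /commgP/conjg_fixP -> : commute (z ^ cyc_in (lead i g)) m.
  apply: (@par_comm _ _ (pred1 i) (cycle_adj i)) => // [k j /eqP->//|].
  by apply: parJ Pz; apply: par_in; rewrite /= eqxx.
by apply: parJ Pz; apply: par_in; rewrite /= eqxx.
Qed.

Lemma link_normal i g z : par (star i) g -> par (cycle_adj i) z ->
  par (cycle_adj i) (z ^ g).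
Proof.
move=> /star_split[m Lm ->] Lz; rewrite conjgM; apply: parJ => //.
suff /commgP/conjg_fixP -> : commute z (cyc_in (lead i g)) by [].
exact/commute_sym/link_comm.
Qed.

Lemma par_pred1_in i z : par (pred1 i) z <-> exists a : G i, z = cyc_in a.
Proof.
split=> [/par_pred1 ->|[a ->]]; first by exists (lead i z).
exact/par_in/eqxx.
Qed.

End Products.

(** * Automorphisms permute the conjugates of stars and of vertex groups *)

Section VertexImages.
Variables (n : nat) (G : 'Z_n -> groupType).
Hypothesis n_ge5 : (5 <= n)%N.
Hypothesis G_neq1 : forall i, exists g : G i, g <> 1.
Local Notation C := (cyclic_prod G).
Implicit Types (i j k l u v w : 'Z_n) (x y z p q g h s t : C).

Lemma commute_in i j (a : G i) (b : G j) : a <> 1 -> b <> 1 ->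
  commute (cyc_in a) (cyc_in b) -> star i j.
Proof.
move=> a1 b1 /(cent_vertex a1) /(_ j); apply.
by rewrite vlen_in eqxx (introF eqP b1).
Qed.

Lemma gisoJ (f : gaut C) x y : f (x ^ y) = f x ^ f y.
Proof. by rewrite /conjg !gisoM (morph_inv (gisoM f)). Qed.

Lemma gisoC (f : gaut C) x y : commute (f x) (f y) <-> commute x y.
Proof.
split=> [e|e]; last by rewrite /commute -!gisoM e.
by apply: (can_inj (gisoK f)); rewrite !gisoM.
Qed.

Lemma giso_eq1 (f : gaut C) x : x <> 1 -> f x <> 1.
Proof.
move=> x1 fx; apply: x1; apply: (can_inj (gisoK f)).
by rewrite fx (morph_one (gisoM f)).
Qed.

Lemma star_image_sub (f : gaut C) i : exists x k,
  forall z, par (star i) z -> par (star k) (f z ^ x).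
Proof.
pose A z := exists a : G i, z = f (cyc_in a).
pose B z := exists2 m, par (cycle_adj i) m & z = f m.
have [|||x [k hx]] := @star_product _ _ n_ge5 A B.
- by move=> _ _ [a ->] [m Lm ->]; apply/gisoC/link_comm.
- have [a a1] := G_neq1 i; exists (f (cyc_in a)); first by exists a.
  exact/giso_eq1/cyc_in_neq1.
- have [a a1] := G_neq1 (i - 1)%R; have [b b1] := G_neq1 (i + 1)%R.
  exists (f (cyc_in a)), (f (cyc_in b)); split.
  + by exists (cyc_in a) => //; apply: par_in; rewrite cycle_adj_sym adj_pred.
  + by exists (cyc_in b) => //; apply: par_in; rewrite adj_succ.
  + move=> /gisoC /(commute_in a1 b1).
    by apply/negP; apply: pred_succ_nstar.
exists x, k => z /star_split[m Lm ->]; rewrite gisoM conjMg.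
by apply: parM; apply: hx; [left; exists (lead i z)|right; exists m].
Qed.

(** Going back by the inverse of [f] sends the star of [i] into a conjugate of a star. Were this a
    different wall, [star_cap_edges] would squeeze [i - 1] and [i + 1] into one edge. *)
Lemma star_image (f : gaut C) i : exists x k,
  forall z, par (star i) z <-> par (star k) (f z ^ x).
Proof.
have [x [k hx]] := star_image_sub f i; exists x, k => z; split; first exact: hx.
have [y [l hy]] := star_image_sub (giso_sym f) k.
have hxy t : par (star k) (f t ^ x) -> par (star l) (t ^ (giso_sym f x * y)).
  by move=> /hy; rewrite gisoJ /= gisoK conjgM.
have [e S] : i = l /\ par (star i) (giso_sym f x * y).
  apply: contrapT => ng; have ng' : i = l -> ~ par (star i) (giso_sym f x * y).
    by move=> e S; apply: ng.
  have [x0 [l0 hl0]] := star_cap_edges n_ge5 ng'.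
  have edge j : star i j -> (j == l0) || (j == l0 + 1)%R.
    move=> ij; have [a a1] := G_neq1 j.
    have Sa : par (star i) (cyc_in a) by apply: par_in.
    have /hl0/(_ (hxy _ (hx _ Sa))) P := Sa.
    apply/negPn/negP => nP; have := par_ret P nP; rewrite retJ ret_in => /eqP.
    by rewrite conjg_eq1 => /eqP.
  have := edge _ (adj_star (adj_succ i)).
  have := edge (i - 1)%R _.
  rewrite star_sym (adj_star (adj_pred i)) => /(_ isT).
  have /negP ns := pred_succ_nstar n_ge5 i.
  case/orP => /eqP e1; case/orP => /eqP e2; apply: ns; rewrite e1 e2.
  - exact: starxx.
  - exact/adj_star/adj_succ.
  - by rewrite star_sym; apply/adj_star/adj_succ.
  - exact: starxx.
subst l; move=> /hxy h; rewrite -[z](conjgK (giso_sym f x * y)).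
by apply: parJ => //; apply/parV.
Qed.

Lemma vertex_stars i z : par (pred1 i) z <->
  par (star (i - 1)%R) z /\ par (star (i + 1)%R) z.
Proof.
split=> [Pz|[S1 S2] j v0]; last first.
  by apply/eqP; apply: pred_succ_star => //; [apply: S1|apply: S2].
split; apply: par_sub Pz => j /eqP ->; first exact/adj_star/adj_pred.
by rewrite star_sym; apply/adj_star/adj_succ.
Qed.

(* The conjugates of the vertex groups are the minimal nontrivial intersections
   of two conjugates of stars. *)
Lemma vertex_preimage (f : gaut C) i : exists x l, forall z,
  par (pred1 l) z -> par (pred1 i) (giso_sym f (z ^ x)).
Proof.
have [x1 [k1 h1]] := star_image f (i - 1)%R.
have [x2 [k2 h2]] := star_image f (i + 1)%R.
have [a a1] := G_neq1 i.
have /vertex_stars[/h1 S1 /h2 S2] : par (pred1 i) (cyc_in a).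
  exact/par_in/eqxx.
have w1 : f (cyc_in a) ^ x1 <> 1 by apply/conjg_neq1/giso_eq1/cyc_in_neq1.
have [|x [l hl]] := star_cap_vertex (g := x1^-1 * x2) w1 S1 (w := k2).
  by rewrite -conjgM mulVKg.
exists (x * x1^-1), l => z /par_pred1_in[c ->]; have [c1 c2] := hl c.
apply/vertex_stars; split; [apply/h1|apply/h2]; rewrite /= gisoKV.
  by rewrite -conjgM mulgVK.
by rewrite -conjgM -mulgA conjgM.
Qed.

(** The inclusions obtained for [f] and for its inverse compose to a conjugation by an element of
    the star of [i], which normalizes [G i]; so both are equalities. *)
Lemma vertex_image (f : gaut C) i : exists x k,
  forall z, par (pred1 i) z <-> par (pred1 k) (f z ^ x).
Proof.
have [x [l hx]] := vertex_preimage f i.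
have [y [m hy]] := vertex_preimage (giso_sym f) l.
set f' := giso_sym f in hx hy.
have hf z : giso_sym f' z = f z by [].
have [c c1] := G_neq1 m.
have Pc : par (pred1 m) (cyc_in c) by apply/par_in/eqxx.
have /hx := hy _ Pc; rewrite hf gisoJ /= gisoK -conjgM.
move=> /par_pred1_in[d /(conj_vertex c1)[? Sg]]; subst m.
exists x^-1, l => z; split=> [Pz|/hx]; last first.
  by rewrite conjgKV /= gisoK.
have := hy _ (pred1_normal (_ : par (star i) (y * f' x)^-1) Pz).
rewrite hf -conjgM invgM mulgVK gisoJ (morph_inv (gisoM f)) /= gisoKV.
by apply; rewrite -invgM; apply/parV.
Qed.

End VertexImages.

(** * Cycles of walls *)

Section PingPong.
Variables (n : nat) (G : 'Z_n -> groupType).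
Hypothesis n_ge5 : (5 <= n)%N.
Hypothesis G_neq1 : forall i, exists g : G i, g <> 1.
Local Notation C := (cyclic_prod G).
Variables (f : gaut C) (x : 'Z_n -> C) (s : 'Z_n -> 'Z_n).
Hypothesis fx : forall i z, par (pred1 i) z <-> par (pred1 (s i)) (f z ^ x i).
Implicit Types (i j k l u v w : 'Z_n) (y z p q g h t : C).

Lemma image_letter i (a : G i) : a <> 1 ->
  exists2 c : G (s i), c <> 1 & f (cyc_in a) ^ x i = cyc_in c.
Proof.
move=> a1; have /fx/par_pred1_in[c ec] : par (pred1 i) (cyc_in a).
  exact/par_in/eqxx.
exists c => // c1.
apply: (conjg_neq1 (x i) (giso_eq1 (f := f) (cyc_in_neq1 a1))).
by rewrite ec c1 cyc_in1.
Qed.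

Lemma image_adj i j : cycle_adj i j ->
  [/\ cycle_adj (s i) (s j),
      exists p q, [/\ par (star (s i)) p, par (star (s j)) q
        & (x i)^-1 * x j = p * q]
    & forall b : G j, par (cycle_adj (s i)) (f (cyc_in b) ^ x i)].
Proof.
move=> ij; have [a a1] := G_neq1 i; have [a' a1' ea] := image_letter a1.
have [b b1] := G_neq1 j; have [b' b1' eb] := image_letter b1.
have Sb (c : G j) : par (star (s i)) (f (cyc_in c) ^ x i).
  by apply: (cent_vertex a1'); rewrite -ea; apply/commuteJ/gisoC/cyc_inC.
have eJ z : f z ^ x i = (f z ^ x j) ^ ((x i)^-1 * x j)^-1.
  by rewrite -conjgM invgM invgK mulVKg.
have [sij [p [q [Sp Sq epq]]]] : star (s i) (s j) /\ exists p q,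
    [/\ par (star (s i)) p, par (star (s j)) q & (x i)^-1 * x j = p * q].
  by apply: (star_meet b1'); rewrite -eb -eJ.
have nsij : s i != s j.
  apply/eqP => e; have : par (pred1 (s i)) (f (cyc_in b) ^ x i).
    rewrite eJ eb epq e; apply: pred1_normal; last exact/par_in/eqxx.
    by apply/parV/parM => //; rewrite -e.
  move=> /(proj2 (fx i _)) /(_ j); rewrite vlen_in eqxx (introF eqP b1).
  move=> /(_ isT) /= /eqP ji.
  by move: ij; rewrite ji cycle_adj_irr.
rewrite star_adj // in sij; split=> //; first by exists p, q.
move=> c; rewrite eJ epq invgM conjgM; apply: link_normal; first exact/parV.
have /fx P : par (pred1 j) (cyc_in c) by apply/par_in/eqxx.
apply: (@par_sub _ _ (pred1 (s j))) => [k /eqP-> //|].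
by apply: (pred1_normal _ P); apply/parV.
Qed.

(** Were the walls equal or transverse, the images of [G i] and [G j] would commute or lie in a
    conjugate of a single vertex group, against the injectivity of [f] or [fx]. *)
Lemma image_apart i j : ~~ star i j ->
  apart (s i) (s j) ((x i)^-1 * x j).
Proof.
move=> nij [sij [p [q [Sp Sq epq]]]].
have [a a1] := G_neq1 i; have [a' a1' ea] := image_letter a1.
have [b b1] := G_neq1 j; have [b' b1' eb] := image_letter b1.
have Pa : par (pred1 (s i)) (f (cyc_in a) ^ (x i * p)).
  by rewrite conjgM ea; apply: pred1_normal Sp _; apply/par_in/eqxx.
have Pb : par (pred1 (s j)) (f (cyc_in b) ^ (x i * p)).
  have -> : x i * p = x j * q^-1.
    by rewrite -[x j](mulVKg (x i)) epq !mulgA mulgK.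
  rewrite conjgM eb; apply: pred1_normal; first exact/parV.
  exact/par_in/eqxx.
have [e|nsij] := eqVneq (s i) (s j); last first.
  rewrite star_adj // in sij; case/negP: nij.
  apply: (commute_in a1 b1); apply/(gisoC f).
  rewrite -(conjgK (x i * p) (f (cyc_in a))) -(conjgK (x i * p) (f (cyc_in b))).
  by apply: commuteJ; apply: par_comm Pa Pb => k l /eqP-> /eqP->.
have : par (pred1 (s i)) (f (cyc_in b) ^ x i).
  rewrite -e in Pb; rewrite -(conjgK p (_ ^ _)) -(conjgM _ (x i)).
  by apply: (pred1_normal _ Pb); apply/parV.
move=> /(proj2 (fx i _)) /(_ j); rewrite vlen_in eqxx (introF eqP b1).
move=> /(_ isT) /= /eqP ji.
by move: nij; rewrite ji starxx.
Qed.

(* The sector of [p] delimited by the wall [x i S_(s i)]. *)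
Definition sector i p := lead (s i) ((x i)^-1 * p).

(** Walls of consecutive vertices have a common point, and the vertices far from [i] form a path. *)
Lemma sector_far i j k : ~~ star i j -> ~~ star i k ->
  sector i (x j) = sector i (x k).
Proof.
pose P l := sector i (x j) = sector i (x l).
move=> ij ik; apply: (@far_connected _ n_ge5 i P _ j k ij ik) => // l nl nl1.
rewrite /P; suff -> : sector i (x l) = sector i (x (l + 1)%R) by [].
have [_ [p [q [Sp Sq e]]] _] := image_adj (adj_succ l).
rewrite /sector -(lead_wall (image_apart nl) Sp).
rewrite -(lead_wall (image_apart nl1) (_ : par _ q^-1)); last exact/parV.
congr lead; rewrite -!mulgA; congr (_ * _).
by rewrite -[x (l + 1)%R](mulVKg (x l)) e -!mulgA mulgV mulg1.
Qed.

Lemma peripheral_ex : exists p, forall i j, ~~ star i j ->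
  sector i (x j) = sector i p.
Proof.
(* The minimum is taken over [p] and over one point [x j * d j] of each wall at once. *)
pose cost p (d : 'Z_n -> C) := (\sum_j len (p^-1 * (x j * d j)))%N.
have [p [d [Sd dmin]]] : exists p d, (forall j, par (star (s j)) (d j)) /\
    forall p' d', (forall j, par (star (s j)) (d' j)) ->
      (cost p d <= cost p' d')%N.
  have ex : exists m, `[< exists p d,
      (forall j, par (star (s j)) (d j)) /\ cost p d = m >].
    exists (cost 1 (fun=> 1)); apply/asboolP; exists 1, (fun=> 1).
    by split=> // j; apply: par1.
  case: (ex_minnP ex) => m /asboolP[p [d [Sd et]]] hmin.
  exists p, d; split=> // p' d' Sd'; rewrite et; apply: hmin.
  by apply/asboolP; exists p', d'.
exists p => i j0 nij0; apply: contrapT => ne.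
(* The rotation [r^-1] around the wall of [i] carries [p] into the sector of [x j0]. *)
pose c := sector i p * (sector i (x j0))^-1.
have [r rJ] : exists r, r = cyc_in c ^ (x i)^-1 by exists (cyc_in c ^ (x i)^-1).
have rE : r = x i * cyc_in c * (x i)^-1 by rewrite rJ /conjg invgK mulgA.
have far_lt j : ~~ star i j ->
    (len ((r^-1 * p)^-1 * (x j * d j)) < len (p^-1 * (x j * d j)))%N.
  move=> nij; pose X := p^-1 * x i.
  have eo : lead (s i) X^-1 = sector i p by rewrite /X invgM invgK.
  have et : lead (s i) (X^-1 * (p^-1 * (x j * d j))) = sector i (x j0).
    rewrite /X invgM invgK -!mulgA mulVKg mulgA.
    rewrite (lead_wall (image_apart nij)) //; exact: sector_far.
  have := @fold_lt _ _ n_ge5 (s i) X (p^-1 * (x j * d j)).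
  rewrite eo et -/c => /(_ ne); congr (_ < _)%N; congr len.
  by rewrite /X rE !invgM !invgK !mulgA mulgK.
have near_par j : star i j -> par (star (s j)) (r^-1 ^ x j).
  move=> ij; rewrite conjVg; apply/parV.
  have [z ez] : exists z, r = f z by exists (giso_inv f r); rewrite gisoKV.
  have Pz : par (pred1 i) z.
    by apply/fx; rewrite -ez rJ conjgKV; apply/par_in/eqxx.
  have [e|nij] := eqVneq i j.
    by subst j; rewrite rJ conjgKV; apply: par_star_in.
  rewrite star_adj // cycle_adj_sym in ij; have [_ _ h] := image_adj ij.
  rewrite ez (par_pred1 Pz); exact/link_star.
(* Walls equal or transverse to that of [i] are preserved by the rotation, so their chosen points
   can follow [p] at the same distance. *)
pose d' j := if star i j then r^-1 ^ x j * d j else d j.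
have Sd' j : par (star (s j)) (d' j).
  by rewrite /d'; case: ifP => // ij; apply: parM => //; apply: near_par.
have near_eq j : star i j -> (r^-1 * p)^-1 * (x j * d' j) = p^-1 * (x j * d j).
  by move=> ij; rewrite /d' ij (conjgE r^-1) invgM invgK -!mulgA !mulVKg.
have := dmin (r^-1 * p) d' Sd'; rewrite leqNgt => /negP; apply.
rewrite /cost (bigD1 j0) //= [X in (_ < X)%N](bigD1 j0) //= -addSn.
apply: leq_add; first by rewrite /d' (negbTE nij0); apply: far_lt.
apply: leq_sum => j _; case: (boolP (star i j)) => ij; first by rewrite near_eq.
by apply: ltnW; rewrite /d' (negbTE ij); apply: far_lt.
Qed.

Lemma ping_pong p : (forall i j, ~~ star i j -> sector i (x j) = sector i p) ->
  forall g i, sector i (f g * p) =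
    ret (s i) (f (cyc_in (lead i g)) ^ x i) * sector i p.
Proof.
move=> hp; elim/red_ind => [|w a g a1 hg IHg] i.
  by rewrite lead1 cyc_in1 (morph_one (gisoM f)) conj1g ret1 !mul1g.
have eq_sector k : sector k (f (cyc_in a * g) * p) =
    lead (s k) (f (cyc_in a) ^ x k * ((x k)^-1 * (f g * p))).
  by rewrite /sector gisoM /conjg -!mulgA mulVKg.
have [c c1 ec] := image_letter a1.
have sw : sector w (f (cyc_in a * g) * p) = c * sector w p.
  rewrite eq_sector ec leadM -/(sector w (f g * p)) IHg hg cyc_in1.
  by rewrite (morph_one (gisoM f)) conj1g ret1 mul1g.
have [e|iw] := eqVneq i w.
  by subst i; rewrite sw leadM hg mulg1 ec ret_in.
have [wi|nwi] := boolP (cycle_adj w i).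
  have iw' : cycle_adj i w by rewrite cycle_adj_sym.
  have [_ _ Lw] := image_adj iw'.
  by rewrite eq_sector lead_adj // lead_link // IHg.
(* The wall of [w] separates the new point from the wall of [i], so [lead_nested] puts this point in
   the sector of [i] that contains the wall of [w], which is also that of [p]. *)
rewrite lead_far ?hg ?mulg1 // cyc_in1 (morph_one (gisoM f)) conj1g ret1 mul1g.
have niw : ~~ star i w by rewrite star_adj // cycle_adj_sym.
have nwi' : ~~ star w i by rewrite star_sym.
rewrite -(hp _ _ niw); apply: (lead_nested (image_apart niw)).
rewrite invgM invgK -!mulgA mulVKg -/(sector w _) sw.
rewrite -/(sector w (x i)) (hp _ _ nwi').
by rewrite -[X in _ <> X]mul1g => /mulIg.
Qed.

Lemma image_standard : exists p, injective s /\
  forall i z, par (pred1 i) z <-> par (pred1 (s i)) (f z ^ p).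
Proof.
have [p hp] := peripheral_ex; exists p.
have ex v : exists k, s k = v /\ par (star (s k)) ((x k)^-1 * p).
  (* [f g] moves [p] to its neighbour [p * cyc_in b]. By [ping_pong] this edge crosses the wall of
     some [k], so it has the type of this wall and starts on it. *)
  have [b b1] := G_neq1 v; pose g := giso_inv f (cyc_in b ^ p^-1).
  have eg : f g * p = p * cyc_in b.
    by rewrite /g gisoKV /conjg invgK -!mulgA mulVg mulg1.
  have g1 : g <> 1.
    apply: (giso_eq1 (f := giso_sym f)); apply: conjg_neq1; exact: cyc_in_neq1.
  have [k hk] := lead_ex g1; exists k.
  have := ping_pong hp g k; rewrite eg /sector mulgA => e.
  have /lead_step[-> Sp] : lead (s k) ((x k)^-1 * p * cyc_in b) <>
      lead (s k) ((x k)^-1 * p); last by [].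
  rewrite e -[X in _ <> X]mul1g => /mulIg.
  by have [c c1 ->] := image_letter hk; rewrite ret_in.
have [r hr] := choice ex.
have rK : cancel r s by move=> v; have [] := hr v.
(* On a finite set, the right inverse [r] of [s] is also a left inverse. *)
have sK : cancel s r by apply: canF_sym rK.
split=> [|i z]; first exact: can_inj sK.
have Sp : par (star (s i)) ((x i)^-1 * p).
  by have [_] := hr (s i); rewrite sK.
have ep y : y ^ p = (y ^ x i) ^ ((x i)^-1 * p) by rewrite -conjgM mulVKg.
split=> [/fx P|P]; first by rewrite ep; apply: pred1_normal.
apply/fx; rewrite -(conjgK ((x i)^-1 * p) (_ ^ x i)) -ep.
by apply: (pred1_normal _ P); apply/parV.
Qed.

End PingPong.

(** * The automorphism group *)

Section InnerAutomorphisms.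
Variable H : groupType.
Implicit Types x y : H.

Lemma inner_morph x : {morph (fun y => x * y * x^-1) : y z / y * z}.
Proof. by move=> y z; rewrite -!mulgA mulKg. Qed.

Lemma innerK x : cancel (fun y => x * y * x^-1) (fun y => x^-1 * y * x).
Proof. by move=> y; rewrite -!mulgA mulKg mulVg mulg1. Qed.

Lemma innerKV x : cancel (fun y => x^-1 * y * x) (fun y => x * y * x^-1).
Proof. by move=> y; rewrite -!mulgA mulVKg mulgV mulg1. Qed.

Definition inner x : gaut H := GIso (inner_morph x) (innerK x) (innerKV x).

Lemma innerE x y : inner x y = y ^ x^-1.
Proof. by rewrite /conjg invgK mulgA. Qed.

Lemma innerM x y : inner (x * y) = inner x * inner y.
Proof. by apply: giso_ext => z; rewrite gautM !innerE invgM conjgM. Qed.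

Lemma inner_gaut (a : gaut H) x : inner (a x) = a * inner x * a^-1.
Proof.
apply: giso_ext => y; rewrite !gautM /= !gisoM (morph_inv (gisoM a)).
by rewrite gisoKV.
Qed.

Lemma isomorphic_bij (K : groupType) (f : K -> H) : {morph f : k k' / k * k'} ->
  injective f -> (forall y, exists k, f k = y) -> isomorphic H K.
Proof.
move=> fM finj fsurj; have [g gK] := choice fsurj.
have fK : cancel f g by move=> k; apply: finj; rewrite gK.
by exists; apply: giso_sym; apply: (GIso fM fK gK).
Qed.

End InnerAutomorphisms.

Section Automorphisms.
Variables (n : nat) (G : 'Z_n -> groupType).
Hypothesis n_ge5 : (5 <= n)%N.
Hypothesis G_neq1 : forall i, exists g : G i, g <> 1.
Local Notation C := (cyclic_prod G).

(** Adjacency of distinct vertices amounts to commutation of nontrivial letters, which [b] preserves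
    in both directions. *)
Lemma standard_Loc (b : gaut C) (s : 'Z_n -> 'Z_n) : injective s ->
  (forall i z, par (pred1 i) z <-> par (pred1 (s i)) (b z)) -> Loc G b.
Proof.
move=> sI hb; exists (perm sI).
have bE i (a : G i) : exists c : G (s i), b (cyc_in a) = cyc_in c.
  by apply/par_pred1_in/(proj1 (hb i _))/par_in/eqxx.
have bVE i (c : G (s i)) : exists a : G i, giso_inv b (cyc_in c) = cyc_in a.
  by apply/par_pred1_in/(proj2 (hb i _)); rewrite gisoKV; apply/par_in/eqxx.
split.
  apply/cycle_symmetryP => i j; rewrite !permE.
  have [->|ij] := eqVneq i j; first by rewrite !cycle_adj_irr.
  have sij : s i != s j by rewrite (inj_eq sI).
  have [a a1] := G_neq1 i; have [c ec] := bE i a.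
  have [a' a1'] := G_neq1 j; have [c' ec'] := bE j a'.
  have c1 : c <> 1.
    move=> c1; apply: (giso_eq1 (f := b) (cyc_in_neq1 a1)).
    by rewrite ec c1 cyc_in1.
  have c1' : c' <> 1.
    move=> c1'; apply: (giso_eq1 (f := b) (cyc_in_neq1 a1')).
    by rewrite ec' c1' cyc_in1.
  apply/idP/idP => adj.
    rewrite -star_adj //; apply: (commute_in a1 a1'); apply/(gisoC b).
    by rewrite ec ec'; apply: cyc_inC.
  rewrite -star_adj //; apply: (commute_in c1 c1'); rewrite -ec -ec'.
  by apply/gisoC/cyc_inC.
suff phi i : exists phi : giso (G i) (G (s i)),
    forall a, b (cyc_in a) = cyc_in (phi a).
  have ex i : exists phi : giso (G i) (G (perm sI i)),
    forall a, b (cyc_in a) = cyc_in (phi a) by rewrite permE; apply: phi.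
  by exists (fun i => sval (cid (ex i))) => i; apply: (svalP (cid (ex i))).
pose f (a : G i) := ret (s i) (b (cyc_in a)).
pose g (c : G (s i)) := ret i (giso_inv b (cyc_in c)).
have fE a : b (cyc_in a) = cyc_in (f a).
  by have [c ec] := bE i a; rewrite /f ec ret_in.
have gE c : giso_inv b (cyc_in c) = cyc_in (g c).
  by have [a ea] := bVE i c; rewrite /g ea ret_in.
have fM : {morph f : x y / x * y}.
  by move=> x y; rewrite /f cyc_inM gisoM retM.
have fK : cancel f g.
  by move=> x; apply: (@cyc_in_inj _ G); rewrite -gE -fE gisoK.
have gK : cancel g f.
  by move=> x; apply: (@cyc_in_inj _ G); rewrite -fE -gE gisoKV.
by exists (GIso fM fK gK).
Qed.

Lemma gaut_inner_Loc (a : gaut C) : exists x b, Loc G b /\ a = inner x * b.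
Proof.
have [xk hxk] : {xk : 'Z_n -> C * 'Z_n & forall i z,
    par (pred1 i) z <-> par (pred1 (xk i).2) (a z ^ (xk i).1)}.
  apply: (@choice _ _ (fun i xk => forall z,
    par (pred1 i) z <-> par (pred1 xk.2) (a z ^ xk.1))) => i.
  by have [x [k h]] := vertex_image n_ge5 G_neq1 a i; exists (x, k).
have [p [sI hp]] := image_standard n_ge5 G_neq1 hxk.
exists p, (inner p^-1 * a); split; last first.
  rewrite mulgA -innerM mulgV; apply: giso_ext => z.
  by rewrite gautM innerE invg1 conjg1.
apply: (standard_Loc sI) => i z.
by rewrite gautM innerE invgK; apply: hp.
Qed.

Variable th : transport G.

Definition inner_loc (k : sdprod (loc_act th)) : gaut C :=
  inner k.1 * loc_act th k.2.

Lemma inner_locM : {morph inner_loc : k k' / k * k'}.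
Proof.
case=> [x k] [y k'].
rewrite -[LHS]/(inner (x * loc_act th k y) * loc_act th (k * k')) loc_actM.
by rewrite innerM inner_gaut -!mulgA mulKg.
Qed.

(** For an element of the kernel, conjugation by [x] maps each [G i] into [G (s i)]. Hence [s] fixes
    every vertex and [x] lies in every star, and no vertex belongs to all stars. *)
Lemma inner_loc_inj : injective inner_loc.
Proof.
suff inj1 k : inner_loc k = 1 -> k = 1.
  move=> k k' e; apply/divg1_eq/inj1.
  by rewrite inner_locM (morph_inv inner_locM) e mulgV.
case: k => x [a s] e.
have E i (g : G i) :
    cyc_in g ^ x = cyc_in (a (s i) (theta th (sym_iso s i) g)).
  have : inner x (loc_act_fun ((a, s) : loc_group th) (cyc_in g)) = cyc_in g.
    by rewrite -[LHS]/(inner_loc (x, (a, s)) (cyc_in g)) e.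
  by rewrite loc_act_in innerE => {1}<-; rewrite conjgKV.
have [s1 Sx] : s = 1 /\ forall i, par (star i) x.
  have h i : i = s i /\ par (star i) x.
    by have [g g1] := G_neq1 i; apply: conj_vertex g1 (E i g).
  split=> [|i]; last by have [] := h i.
  apply: val_inj; apply/permP => i; rewrite perm1.
  by have [] := h i.
have x1 : x = 1.
  apply: (@par_pred0 n G) => j v0; have [i /negP] := not_all_star n_ge5 j.
  by case; apply: Sx.
subst x s; congr (_, (_, _)); apply: prod_gaut_ext => i g.
have := E i g; rewrite conjg1; move: (sym_iso _ _); rewrite sym1 => hi.
by rewrite theta_id => /cyc_in_inj <-.
Qed.

Lemma Loc_loc_act (b : gaut C) : Loc G b -> exists k, b = loc_act th k.
Proof.
case=> s [cs [phi hphi]].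
have sP : sym_pred G s.
  apply/andP; split=> //; apply/asboolP => i.
  by exists; apply/giso_sym/phi.
pose S := MkSym sP.
have bE i j (g : G i) : j = s i -> b (cyc_in g) = cyc_in (ret j (b (cyc_in g))).
  by move=> ->; rewrite hphi ret_in.
have bVE i j (g : G j) : j = s i ->
    giso_inv b (cyc_in g) = cyc_in (ret i (giso_inv b (cyc_in g))).
  move=> e; subst j; rewrite -[g](gisoKV (phi i)) -hphi gisoK ret_in //.
(* Quantifying over [i] with [j = s i] avoids a cast between [G (s i)] and [G j]. *)
have aj j : exists aj : gaut (G j), forall i (hi : isomorphic (G i) (G j)) g,
    j = s i -> b (cyc_in g) = cyc_in (aj (theta th hi g)).
  pose i := S^-1 j; have ji : j = s i by rewrite -[LHS](symKV S).
  have hi : isomorphic (G i) (G j) := sym_iso_pred S j.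
  pose t := theta th hi.
  pose f (g : G j) := ret j (b (cyc_in (giso_inv t g))).
  pose g (c : G j) := t (ret i (giso_inv b (cyc_in c))).
  have fM : {morph f : x y / x * y}.
    by move=> x y; rewrite /f gisoVM cyc_inM gisoM retM.
  have fK : cancel f g.
    move=> c; rewrite /f /g -(bE i j) // gisoK ret_in gisoKV //.
  have gK : cancel g f.
    by move=> c; rewrite /f /g gisoK -(bVE i j) // gisoKV ret_in.
  exists (GIso fM fK gK) => i' hi' c e.
  have ei : i' = i by apply: (@perm_inj _ s); rewrite -e.
  subst i'; rewrite (Prop_irrelevance hi' hi) /= /f gisoK.
  exact: bE.
exists (fun j => sval (cid (aj j)), S); apply: giso_ext.
apply: cyc_morph_eq; [exact: gisoM|exact: gisoM|move=> i g].
rewrite /= loc_act_in /=; apply: (svalP (cid (aj (s i)))) => //.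
Qed.

End Automorphisms.

Theorem theorem4p7 (n : nat) (G : 'Z_n -> groupType) (th : transport G) :
  (5 <= n)%N ->
  (forall i, exists g : G i, g <> 1) ->
  [set: gaut (cyclic_prod G)]%classic =
    [set a * b | a in Inn (cyclic_prod G) & b in Loc G]%classic /\
  isomorphic (gaut (cyclic_prod G)) (sdprod (loc_act th)).
Proof.
move=> n_ge5 G_neq1; split.
  apply/seteqP; split=> // a _.
  have [x [b [Lb ->]]] := gaut_inner_Loc n_ge5 G_neq1 a.
  by exists (inner x); [exists x|exists b].
apply: (isomorphic_bij (@inner_locM _ _ th)) => [|a].
  exact: inner_loc_inj.
have [x [b [/(Loc_loc_act th)[k ->] ->]]] := gaut_inner_Loc n_ge5 G_neq1 a.
by exists (x, k).
Qed.
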